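(* In the ring $\mathfrak P[[x]]$ of formal power series over the polytope ring, the series $$\alpha(x)=x+\sum_{n=1}^\infty \mathfrak a_n x^{n+1},\qquad \beta(x)=x-\sum_{n=1}^\infty \mathfrak a_n^\circ x^{n+1}$$ are compositionally inverse to each other: $\alpha(\beta(x))=x$ and $\beta(\alpha(x))=x$.
   Context: $\mathfrak P$ is the commutative ring freely generated as an abelian group by combinatorial equivalence classes of convex polytopes, with multiplication given by the Cartesian product; the point is the unit. For a polytope $P$, $\mathcal F(P)$ denotes the set of all its nonempty faces (including $P$ itself), each regarded as an element of $\mathfrak P$. The associahedron $\mathfrak a_n$ ($n\ge1$) is the $(n-1)$-dimensional graph-associahedron of the path graph with $n$ vertices, i.e. the polytope $\{x\in\mathbb R^n:\sum_{i=1}^n x_i=3^n,\ \sum_{i=a}^{b}x_i\ge 3^{b-a+1}\text{ for all }1\le a\le b\le n,\ (a,b)\ne(1,n)\}$; in particular $\mathfrak a_1$ is a point. The weighted motivic interior is $\mathfrak a_n^\circ=\sum_{f\in\mathcal F(\mathfrak a_n)}(-\mathfrak a_1)^{\operatorname{codim} f}\, f$. *)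

(* Defs.v *)
From HB Require Import structures.
From mathcomp Require Import all_boot all_order all_algebra.
From mathcomp Require Import all_classical all_reals.
(* The notations of monalg clash with those of mathcomp-classical. *)
From mathcomp Require Import -(notations) monalg.
From mathcomp Require Import zify lra.

Set Implicit Arguments.
Unset Strict Implicit.
Unset Printing Implicit Defensive.

Import Order.TTheory GRing.Theory Num.Theory.

Local Open Scope classical_set_scope.
Local Open Scope ring_scope.

Section DotProduct.
Variable R : realType.

Definition dotp n (u v : 'rV[R]_n) : R := \sum_i u 0 i * v 0 i.

Lemma dotpDr n (u v w : 'rV[R]_n) : dotp u (v + w) = dotp u v + dotp u w.
Proof. by rewrite -big_split; apply: eq_bigr => i _; rewrite mxE mulrDr. Qed.

Lemma dotpZr n (u v : 'rV[R]_n) a : dotp u (a *: v) = a * dotp u v.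
Proof. by rewrite mulr_sumr; apply: eq_bigr => i _; rewrite mxE mulrCA. Qed.

Lemma dotpNr n (u v : 'rV[R]_n) : dotp u (- v) = - dotp u v.
Proof. by rewrite -scaleN1r dotpZr mulN1r. Qed.

Lemma dotpBr n (u v w : 'rV[R]_n) : dotp u (v - w) = dotp u v - dotp u w.
Proof. by rewrite dotpDr dotpNr. Qed.

Lemma dotpNl n (u v : 'rV[R]_n) : dotp (- u) v = - dotp u v.
Proof. by rewrite -sumrN; apply: eq_bigr => i _; rewrite mxE mulNr. Qed.

Lemma dotp0l n (v : 'rV[R]_n) : dotp 0 v = 0.
Proof. by apply: big1 => i _; rewrite mxE mul0r. Qed.

Lemma dotp_row n m (u : 'rV[R]_n) (v : 'rV[R]_m) (w : 'rV[R]_(n + m)) :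
  dotp (row_mx u v) w = dotp u (lsubmx w) + dotp v (rsubmx w).
Proof.
rewrite /dotp big_split_ord /=; congr (_ + _); apply: eq_bigr => i _.
  by rewrite row_mxEl mxE.
by rewrite row_mxEr mxE.
Qed.

Lemma dotp_split n m (u w : 'rV[R]_(n + m)) :
  dotp u w = dotp (lsubmx u) (lsubmx w) + dotp (rsubmx u) (rsubmx w).
Proof. by rewrite -dotp_row hsubmxK. Qed.

End DotProduct.

Section Polytopes.
Variable R : realType.

Definition is_bounded n (A : set 'rV[R]_n) :=
  exists M : R, forall x i, A x -> `|x 0 i| <= M.

(* Finite intersections of closed half-spaces {x | <h.1, x> <= h.2}. *)
Definition is_polyhedron n (A : set 'rV[R]_n) :=
  exists s : seq ('rV[R]_n * R),
    A = [set x | forall h, h \in s -> dotp h.1 x <= h.2].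

(* Polytopes are nonempty, so that [faces] below ranges over the nonempty
   faces only. *)
Record polytope n := Polytope {
  pset :> set 'rV[R]_n ;
  polytope_neq0 : pset !=set0 ;
  polytope_bounded : is_bounded pset ;
  polytope_polyhedron : is_polyhedron pset }.

HB.instance Definition _ n := gen_eqMixin (polytope n).
HB.instance Definition _ n := gen_choiceMixin (polytope n).

Lemma polytope_inj n : injective (@pset n).
Proof.
move=> [A A0 Ab Ap] [B B0 Bb Bp] /= AB; subst B.
by congr Polytope; apply: Prop_irrelevance.
Qed.

(* The points of A at which the linear functional <c, .> is maximal. *)
Definition argmax n (c : 'rV[R]_n) (A : set 'rV[R]_n) : set 'rV[R]_n :=
  [set x | A x /\ forall y, A y -> dotp c y <= dotp c x].

(* c = 0 gives P itself. *)
Definition faces n (P : polytope n) : set (polytope n) :=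
  [set F | exists c, pset F = argmax c P].

(* The dimension of the affine hull of A: the largest k such that A contains
   k + 1 affinely independent points (0 if A is empty). *)
Definition affdim n (A : set 'rV[R]_n) : nat :=
  \max_(k < n.+1 | `[< exists (p : 'rV[R]_n) (q : 'I_k -> 'rV[R]_n),
     [/\ A p, forall i, A (q i) & row_free (\matrix_i (q i - p))] >]) k.

Definition codim n (P F : polytope n) : nat := (affdim P - affdim F)%N.

(* Combinatorial equivalence: isomorphism of the posets of nonempty faces. *)
Definition comb_equiv n m (P : polytope n) (Q : polytope m) :=
  exists2 phi : polytope n -> polytope m,
    set_bij (faces P) (faces Q) phi &
    forall F G, faces P F -> faces P G ->
      pset F `<=` pset G <-> pset (phi F) `<=` pset (phi G).

End Polytopes.
Arguments codim {R n}.

Section FacesFinite.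
Variable R : realType.

Lemma faces_self n (P : polytope R n) : faces P P.
Proof.
exists 0; apply/seteqP; split => [x Px|x []//]; split => // y _.
by rewrite !dotp0l.
Qed.

Lemma face_sub n (P F : polytope R n) : faces P F -> pset F `<=` pset P.
Proof. by move=> [c ->] x []. Qed.

Let tight n (F : polytope R n) (h : 'rV[R]_n * R) :=
  forall x, pset F x -> dotp h.1 x = h.2.

Let face_tight n (P F : polytope R n) (s : seq ('rV[R]_n * R)) :
  pset P = [set x | forall h, h \in s -> dotp h.1 x <= h.2] -> faces P F ->
  pset F = [set x | pset P x /\ forall h, h \in s -> tight F h ->
                    dotp h.1 x = h.2].
Proof.
move=> Ps [c Fc]; apply/seteqP; split => [x Fx|y [Py ty]].
  by split=> [|h _]; [move: Fx; rewrite Fc => -[]|exact].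
have [x [Fx sx]] : exists x, pset F x /\
    forall h, h \in s -> ~ tight F h -> dotp h.1 x < h.2.
  have Fle x h : pset F x -> h \in s -> dotp h.1 x <= h.2.
    by rewrite Fc Ps => -[+ _]; exact.
  have : {subset s <= s} by [].
  elim: {1 3}s => [_|h t IH hts]; first by have [x Fx] := polytope_neq0 F; exists x.
  have [g gt|x [Fx tx]] := IH; first by apply: hts; rewrite inE gt orbT.
  have [th|/existsNP[z /not_implyP[Fz zh]]] := pselect (tight F h).
    by exists x; split=> // g; rewrite inE => /orP[/eqP-> //|]; exact: tx.
  have e : dotp h.1 z < h.2.
    by rewrite lt_neqAle Fle// ?hts ?mem_head// andbT; apply/eqP.
  exists (2^-1 *: x + 2^-1 *: z); split.
    move: Fx Fz; rewrite Fc => -[Px mx] [Pz mz]; split.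
      rewrite Ps in Px Pz *; move=> g gs; rewrite dotpDr !dotpZr.
      by have := Px g gs; have := Pz g gs; lra.
    move=> w Pw; rewrite dotpDr !dotpZr.
    by have := mx w Pw; have := mz w Pw; lra.
  move=> g gt ng; rewrite dotpDr !dotpZr.
  have := gt; rewrite inE => /orP[/eqP gh|/tx /(_ ng) tg].
    by have := Fle x g Fx (hts _ gt); rewrite gh; lra.
  by have := Fle z g Fz (hts _ gt); lra.
have [t [t0 ht]] : exists t : R, 0 < t /\ forall h, h \in s ->
    forall r, 0 <= r <= t -> dotp h.1 (x + r *: (x - y)) <= h.2.
  elim: {Ps} s ty sx => [|h s IH] ty sx; first by exists 1.
  have [g gs|g gs|t [t0 tP]] := IH.
  - by apply: ty; rewrite inE gs orbT.
  - by apply: sx; rewrite inE gs orbT.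
  have [th|nth] := pselect (tight F h).
    exists t; split=> // g; rewrite inE => /orP[/eqP -> r _|]; last exact: tP.
    by rewrite dotpDr dotpZr dotpBr (th _ Fx) (ty h (mem_head _ _) th) subrr mulr0 addr0.
  have hx := sx h (mem_head _ _) nth.
  pose a := dotp h.1 (x - y); pose e := h.2 - dotp h.1 x.
  have e0 : 0 < e by rewrite subr_gt0.
  exists (Num.min t (e / (1 + `|a|))); have a1 : 0 < 1 + `|a| by rewrite ltr_pwDl.
  split; first by rewrite lt_min t0 divr_gt0.
  move=> g gs r /andP[r0]; rewrite le_min => /andP[rt re].
  have := gs; rewrite inE => /orP[/eqP ->|/tP]; last by apply; rewrite r0.
  rewrite dotpDr dotpZr -/a -lerBrDl -/e.
  move: re; rewrite ler_pdivlMr// => re; apply: le_trans re.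
  by rewrite ler_wpM2l// (le_trans (ler_norm a))// lerDr.
have Pz : pset P (x + t *: (x - y)).
  by rewrite Ps => h hs; apply: ht => //; rewrite lexx ltW.
move: Fx; rewrite Fc => -[Px mx]; split=> // w Pw.
apply: le_trans (mx _ Pw) _; have := mx _ Pz.
by rewrite dotpDr dotpZr dotpBr gerDl pmulr_rle0// subr_le0.
Qed.

Lemma finite_faces n (P : polytope R n) : finite_set (faces P).
Proof.
have [s Ps] := polytope_polyhedron P.
pose f (F : polytope R n) := [ffun i : 'I_(size s) => `[< tight F s`_i >]].
have fI : {in faces P &, injective f}.
  move=> F G /set_mem PF /set_mem PG /ffunP fFG; apply: polytope_inj.
  rewrite (face_tight Ps PF) (face_tight Ps PG).
  suff tE h : h \in s -> tight F h <-> tight G h.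
    by apply/seteqP; split=> x [Px tx]; split=> // h hs /(tE _ hs); exact: tx.
  move=> hs; have /(nthP 0)[i ilt <-] := hs.
  have := fFG (Ordinal ilt); rewrite !ffunE /= => E.
  by split=> H; apply/asboolP; [rewrite -E|rewrite E]; apply/asboolP.
rewrite -(eq_finite_set (inj_card_eq fI)); exact: finite_finset.
Qed.

End FacesFinite.

Section Product.
Variable R : realType.

Section Def.
Variables (n m : nat) (P : polytope R n) (Q : polytope R m).

Definition prod_set : set 'rV[R]_(n + m) :=
  [set x | pset P (lsubmx x) /\ pset Q (rsubmx x)].

Lemma prod_neq0 : prod_set !=set0.
Proof.
have [[x Px] [y Qy]] := (polytope_neq0 P, polytope_neq0 Q).
by exists (row_mx x y); rewrite /prod_set /= row_mxKl row_mxKr.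
Qed.

Lemma prod_bounded : is_bounded prod_set.
Proof.
have [[M PM] [N QN]] := (polytope_bounded P, polytope_bounded Q).
exists (Num.max M N) => x i [Px Qx]; rewrite le_max.
case: (split_ordP i) => j ->.
  by have := PM _ j Px; rewrite mxE => ->.
by have := QN _ j Qx; rewrite mxE => ->; rewrite orbT.
Qed.

Lemma prod_polyhedron : is_polyhedron prod_set.
Proof.
have [[s Ps] [t Qt]] := (polytope_polyhedron P, polytope_polyhedron Q).
exists ([seq (row_mx h.1 0, h.2) | h <- s] ++ [seq (row_mx 0 h.1, h.2) | h <- t]).
rewrite /prod_set Ps Qt; apply/seteqP; split=> x /=.
  move=> [hs ht] h; rewrite mem_cat => /orP[] /mapP[g gs ->] /=.
    by rewrite dotp_row dotp0l addr0; exact: hs.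
  by rewrite dotp_row dotp0l add0r; exact: ht.
move=> H; split=> g gs.
  have := H (row_mx g.1 0, g.2); rewrite mem_cat map_f//= dotp_row dotp0l addr0.
  exact.
have := H (row_mx 0 g.1, g.2); rewrite mem_cat (@map_f _ _ _ t)//= orbT.
by rewrite dotp_row dotp0l add0r; exact.
Qed.

Definition polytope_prod : polytope R (n + m) :=
  Polytope prod_neq0 prod_bounded prod_polyhedron.

End Def.

Definition point_set : set 'rV[R]_0 := setT.

Lemma point_neq0 : point_set !=set0. Proof. by exists 0. Qed.

Lemma point_bounded : is_bounded point_set.
Proof. by exists 0 => x []. Qed.

Lemma point_polyhedron : is_polyhedron point_set.
Proof. by exists [::]; apply/seteqP; split. Qed.

Definition point : polytope R 0 :=
  Polytope point_neq0 point_bounded point_polyhedron.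

Lemma faces_prod n m (P : polytope R n) (Q : polytope R m) H :
  faces (polytope_prod P Q) H <->
  exists F G, [/\ faces P F, faces Q G & H = polytope_prod F G].
Proof.
split=> [[c Hc]|[F [G [[c Fc] [d Gd] ->]]]].
  pose A := argmax (lsubmx c) P; pose B := argmax (rsubmx c) Q.
  have HE : pset H = [set x | A (lsubmx x) /\ B (rsubmx x)].
    rewrite Hc; apply/seteqP; split=> x /=.
      move=> [[Px Qx] mx]; split; split=> // y Py.
        have := mx (row_mx y (rsubmx x)).
        rewrite !(dotp_split c) row_mxKl row_mxKr lerD2r; apply.
        by rewrite /prod_set /= row_mxKl row_mxKr.
      have := mx (row_mx (lsubmx x) y).
      rewrite !(dotp_split c) row_mxKl row_mxKr lerD2l; apply.
      by rewrite /prod_set /= row_mxKl row_mxKr.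
    move=> [[Px mx] [Qx my]]; split=> // y [Py Qy].
    by rewrite !(dotp_split c) lerD ?mx ?my.
  have argmax_polytope k (S : polytope R k) (e : 'rV[R]_k) x0 :
      argmax e S x0 -> exists T : polytope R k, pset T = argmax e S.
    move=> Sx0; suff [b p] : is_bounded (argmax e S) /\ is_polyhedron (argmax e S).
      by exists (Polytope (ex_intro _ x0 Sx0) b p).
    split; first by have [M PM] := polytope_bounded S; exists M => x i [/PM].
    have [s Ss] := polytope_polyhedron S.
    exists ((- e, - dotp e x0) :: s); apply/seteqP; split=> x /=.
      move=> [Sx mx] h; rewrite inE => /orP[/eqP ->|] /=.
        by rewrite dotpNl lerN2; apply: mx; case: Sx0.
      by move: Sx; rewrite Ss; exact.
    move=> hx; split; first by rewrite Ss => h hs; apply: hx; rewrite inE hs orbT.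
    have := hx _ (mem_head _ _); rewrite /= dotpNl lerN2 => ex y Sy.
    by apply: le_trans ex; case: Sx0 => _; exact.
  have [x0] := polytope_neq0 H; rewrite HE => -[Ax0 Bx0].
  have [[F FA] [G GB]] := (argmax_polytope _ _ _ _ Ax0, argmax_polytope _ _ _ _ Bx0).
  exists F, G; split; [by exists (lsubmx c)|by exists (rsubmx c)|].
  by apply: polytope_inj; rewrite HE /= /prod_set FA GB.
exists (row_mx c d); rewrite /= /prod_set Fc Gd; apply/seteqP; split=> x /=.
  move=> [[Px mx] [Qx my]]; split=> // y [Py Qy].
  by rewrite !dotp_row lerD ?mx ?my.
move=> [[Px Qx] mx]; split; split=> // y Py.
  have := mx (row_mx y (rsubmx x)).
  rewrite !dotp_row row_mxKl row_mxKr lerD2r; apply.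
  by rewrite /prod_set /= row_mxKl row_mxKr.
have := mx (row_mx (lsubmx x) y).
rewrite !dotp_row row_mxKl row_mxKr lerD2l; apply.
by rewrite /prod_set /= row_mxKl row_mxKr.
Qed.

Lemma prod_subset n m (F F' : polytope R n) (G G' : polytope R m) :
  pset (polytope_prod F G) `<=` pset (polytope_prod F' G') <->
  pset F `<=` pset F' /\ pset G `<=` pset G'.
Proof.
split=> [FG|[FF GG] x [/FF Fx /GG]//].
have [[x Fx] [y Gy]] := (polytope_neq0 F, polytope_neq0 G).
split=> z Fz.
  have [] := FG (row_mx z y); rewrite /= /prod_set /= !row_mxKl !row_mxKr//.
have [] := FG (row_mx x z); rewrite /= /prod_set /= !row_mxKl !row_mxKr//.
Qed.

End Product.

Section PosetIsomorphism.

Definition poset_iso (T U : Type) (A : set T) (rT : T -> T -> Prop)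
    (B : set U) (rU : U -> U -> Prop) :=
  exists (f : T -> U) (g : U -> T),
    [/\ forall x, A x -> B (f x) /\ g (f x) = x,
        forall y, B y -> A (g y) /\ f (g y) = y &
        forall x x', A x -> A x' -> rT x x' <-> rU (f x) (f x')].

Lemma poset_iso_refl T (A : set T) rT : poset_iso A rT A rT.
Proof. by exists id, id; split. Qed.

Lemma poset_iso_sym T U (A : set T) rT (B : set U) rU :
  poset_iso A rT B rU -> poset_iso B rU A rT.
Proof.
move=> [f [g [fP gP fg]]]; exists g, f; split=> // y y' By By'.
have [[Ay E] [Ay' E']] := (gP y By, gP y' By').
by rewrite -{1}E -{1}E'; apply: iff_sym; exact: fg.
Qed.

Lemma poset_iso_trans T U V (A : set T) rT (B : set U) rU (C : set V) rV :
  poset_iso A rT B rU -> poset_iso B rU C rV -> poset_iso A rT C rV.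
Proof.
move=> [f [g [fP gP fg]]] [h [k [hP kP hk]]]; exists (h \o f), (g \o k); split.
- move=> x Ax; have [Bx E] := fP x Ax; have [Cx E'] := hP _ Bx.
  by rewrite /= E' E.
- move=> x Cx; have [Bx E] := kP x Cx; have [Ax E'] := gP _ Bx.
  by rewrite /= E' E.
move=> x x' Ax Ax'; have [[Bx _] [Bx' _]] := (fP x Ax, fP x' Ax').
by apply: iff_trans (fg _ _ Ax Ax') _; exact: hk.
Qed.

Definition prod_rel T U (rT : T -> T -> Prop) (rU : U -> U -> Prop)
  (x y : T * U) := rT x.1 y.1 /\ rU x.2 y.2.

Lemma poset_iso_prod T U T' U' (A : set T) rT (B : set U) rU
    (A' : set T') rT' (B' : set U') rU' :
  poset_iso A rT A' rT' -> poset_iso B rU B' rU' ->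
  poset_iso (A `*` B) (prod_rel rT rU) (A' `*` B') (prod_rel rT' rU').
Proof.
move=> [f [g [fP gP fg]]] [h [k [hP kP hk]]].
exists (fun x => (f x.1, h x.2)), (fun x => (g x.1, k x.2)); split.
- by move=> [x y] [/= /fP[? ->] /hP[? ->]].
- by move=> [x y] [/= /gP[? ->] /kP[? ->]].
move=> [x y] [x' y'] [/= Ax By] [/= Ax' By']; rewrite /prod_rel /=.
by have := fg _ _ Ax Ax'; have := hk _ _ By By'; tauto.
Qed.

Lemma poset_iso_prodC T U (A : set T) rT (B : set U) rU :
  poset_iso (A `*` B) (prod_rel rT rU) (B `*` A) (prod_rel rU rT).
Proof.
exists (fun x => (x.2, x.1)), (fun x => (x.2, x.1)).
split=> [[x y] []//|[x y] []//|]; move=> [x y] [x' y'] _ _.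
by rewrite /prod_rel /=; tauto.
Qed.

Lemma poset_iso_prodA T U V (A : set T) rT (B : set U) rU (C : set V) rV :
  poset_iso (A `*` (B `*` C)) (prod_rel rT (prod_rel rU rV))
            (A `*` B `*` C) (prod_rel (prod_rel rT rU) rV).
Proof.
exists (fun x => (x.1, x.2.1, x.2.2)), (fun x => (x.1.1, (x.1.2, x.2))).
split=> [[x [y z]] [? []]//|[[x y] z] [[]]//|]; move=> [x [y z]] [x' [y' z']] _ _.
by rewrite /prod_rel /=; tauto.
Qed.

End PosetIsomorphism.

Section CombinatorialTypes.
Variable R : realType.

Local Notation subp := (fun F G => pset F `<=` pset G).
Local Notation face_iso P Q := (poset_iso (faces P) subp (faces Q) subp).

Lemma comb_equivP n m (P : polytope R n) (Q : polytope R m) :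
  comb_equiv P Q <-> face_iso P Q.
Proof.
split=> [[phi [pf pi ps] mono]|[f [g [fP gP fg]]]].
  exists phi, (fun G => xget P [set F | faces P F /\ phi F = G]).
  have K G : faces Q G -> let F := xget P [set F | faces P F /\ phi F = G] in
      faces P F /\ phi F = G.
    move=> QG; apply: (@xgetPex _ P [set F | faces P F /\ phi F = G]).
    by have [F PF E] := ps _ QG; exists F.
  split=> // F PF; split; first exact: pf.
  have [PF' E] := K _ (pf _ PF).
  by apply: pi; rewrite ?inE.
exists f; last exact: fg.
split=> [F /fP[]//|F G|G QG].
  by rewrite !inE => /fP[_ {2}<-] /fP[_ {2}<-] ->.
by have [? ?] := gP G QG; exists (g G).
Qed.

Lemma faces_prod_iso n m (P : polytope R n) (Q : polytope R m) :
  poset_iso (faces (polytope_prod P Q)) subp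
            (faces P `*` faces Q) (prod_rel subp subp).
Proof.
pose g (FG : polytope R n * polytope R m) := polytope_prod FG.1 FG.2.
pose S H := [set FG | (faces P `*` faces Q) FG /\ g FG = H].
apply: poset_iso_sym; exists g, (fun H => xget (P, Q) (S H)).
have K H : faces (polytope_prod P Q) H -> S H (xget (P, Q) (S H)).
  move=> /faces_prod[F [G [PF QG E]]]; apply: (@xgetPex _ _ (S H)).
  by exists (F, G).
have gI : injective g.
  move=> [F G] [F' G'] E.
  have /prod_subset[F1 G1] : pset (g (F, G)) `<=` pset (g (F', G')) by rewrite E.
  have /prod_subset[F2 G2] : pset (g (F', G')) `<=` pset (g (F, G)) by rewrite E.
  by congr pair; apply: polytope_inj; apply/seteqP.
split=> [[F G] [PF QG]|H /K//|].
  have Pg : faces (polytope_prod P Q) (g (F, G)) by apply/faces_prod; exists F, G.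
  by split=> //; have [_] := K _ Pg; exact: gI.
by move=> [F G] [F' G'] _ _; apply: iff_sym; exact: prod_subset.
Qed.

Definition any_polytope := {n : nat & polytope R n}.

HB.instance Definition _ := Choice.on any_polytope.

Definition any_of (n : nat) (P : polytope R n) : any_polytope := Tagged _ P.

Definition comb_rel (P Q : any_polytope) : bool :=
  `[< comb_equiv (tagged P) (tagged Q) >].

Lemma comb_rel_refl : reflexive comb_rel.
Proof. by move=> P; apply/asboolP/comb_equivP; exact: poset_iso_refl. Qed.

Lemma comb_rel_sym : symmetric comb_rel.
Proof.
by move=> P Q; apply/asboolP/asboolP => /comb_equivP PQ; apply/comb_equivP;
  exact: poset_iso_sym.
Qed.

Lemma comb_rel_trans : transitive comb_rel.
Proof.
move=> P Q S /asboolP/comb_equivP QP /asboolP/comb_equivP PS.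
by apply/asboolP/comb_equivP; exact: poset_iso_trans QP PS.
Qed.

Canonical comb_rel_equiv :=
  EquivRel comb_rel comb_rel_refl comb_rel_sym comb_rel_trans.

Local Open Scope quotient_scope.

Definition comb_type : Type := {eq_quot comb_rel}.
HB.instance Definition _ := Choice.on comb_type.
HB.instance Definition _ := EqQuotient.on comb_type.

Definition comb_class (n : nat) (P : polytope R n) : comb_type :=
  \pi_comb_type (any_of P).

Lemma comb_classP n m (P : polytope R n) (Q : polytope R m) :
  comb_class P = comb_class Q <-> comb_equiv P Q.
Proof.
split=> [/eqP|PQ]; first by rewrite /comb_class piE => /asboolP.
by apply/eqP; rewrite /comb_class piE; apply/asboolP.
Qed.

Lemma comb_class_surj (a : comb_type) :
  exists n (P : polytope R n), a = comb_class P.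
Proof.
elim/quotW: a => -[n P]; by exists n, P.
Qed.

Lemma comb_equiv_prod n m n' m' (P : polytope R n) (Q : polytope R m)
    (P' : polytope R n') (Q' : polytope R m') :
  comb_equiv P P' -> comb_equiv Q Q' ->
  comb_equiv (polytope_prod P Q) (polytope_prod P' Q').
Proof.
move=> /comb_equivP PP /comb_equivP QQ; apply/comb_equivP.
apply: poset_iso_trans (faces_prod_iso P Q) _.
apply: poset_iso_trans (poset_iso_sym (faces_prod_iso P' Q')).
exact: poset_iso_prod.
Qed.

Definition comb_mul (a b : comb_type) : comb_type :=
  comb_class (polytope_prod (tagged (repr a)) (tagged (repr b))).

Definition comb_one : comb_type := comb_class (point R).

Lemma repr_comb_class n (P : polytope R n) :
  comb_equiv (tagged (repr (comb_class P))) P.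
Proof.
by apply/comb_classP; rewrite {1}/comb_class /any_of; case: (repr _) (reprK (comb_class P)).
Qed.

Lemma comb_mulE n m (P : polytope R n) (Q : polytope R m) :
  comb_mul (comb_class P) (comb_class Q) = comb_class (polytope_prod P Q).
Proof. by apply/comb_classP/comb_equiv_prod; exact: repr_comb_class. Qed.

Lemma comb_mulC : commutative comb_mul.
Proof.
move=> a b; have [n [P ->]] := comb_class_surj a; have [m [Q ->]] := comb_class_surj b.
rewrite !comb_mulE; apply/comb_classP/comb_equivP.
apply: poset_iso_trans (faces_prod_iso P Q) _.
apply: poset_iso_trans (poset_iso_sym (faces_prod_iso Q P)).
exact: poset_iso_prodC.
Qed.

Lemma comb_mulA : associative comb_mul.
Proof.
move=> a b c; have [n [P ->]] := comb_class_surj a.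
have [m [Q ->]] := comb_class_surj b; have [k [S ->]] := comb_class_surj c.
rewrite !comb_mulE; apply/comb_classP/comb_equivP.
apply: poset_iso_trans (faces_prod_iso _ _) _.
apply: poset_iso_trans
  (poset_iso_prod (poset_iso_refl _ _) (faces_prod_iso _ _)) _.
apply: poset_iso_trans (poset_iso_prodA _ _ _ _ _ _) _.
apply: poset_iso_sym; apply: poset_iso_trans (faces_prod_iso _ _) _.
exact: (poset_iso_prod (faces_prod_iso _ _) (poset_iso_refl _ _)).
Qed.

Lemma point_uniq (F : polytope R 0) : F = point R.
Proof.
apply: polytope_inj; apply/seteqP; split=> // x _.
by have [y Fy] := polytope_neq0 F; rewrite (_ : x = y)//; apply/rowP => -[].
Qed.

Lemma comb_mulr1 : right_id comb_one comb_mul.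
Proof.
move=> a; have [n [P ->]] := comb_class_surj a.
rewrite comb_mulE; apply/comb_classP/comb_equivP.
apply: poset_iso_trans (faces_prod_iso _ _) _.
exists fst, (fun F => (F, point R)); split.
- by move=> [F G] [/= PF _]; rewrite (point_uniq G).
- by move=> F PF; do !split => //; exact: faces_self.
by move=> [F G] [F' G'] _ _; rewrite /prod_rel /= (point_uniq G) (point_uniq G'); split=> // -[].
Qed.

Lemma comb_mul1r : left_id comb_one comb_mul.
Proof. by move=> a; rewrite comb_mulC comb_mulr1. Qed.

Lemma comb_mul_eq1 a b : comb_mul a b = comb_one -> a = comb_one /\ b = comb_one.
Proof.
suff H c d : comb_mul c d = comb_one -> c = comb_one.
  by move=> ab; split; [exact: H ab|apply: (H b a); rewrite comb_mulC].
have [n [P ->]] := comb_class_surj c; have [m [Q ->]] := comb_class_surj d.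
rewrite comb_mulE => /comb_classP/comb_equivP /poset_iso_sym PQ.
have [f [g [fP gP _]]] := poset_iso_trans PQ (faces_prod_iso P Q).
have uP F : faces P F -> F = P.
  move=> PF; have [[_ E] [_ E']] := (gP (F, Q) (conj PF (faces_self Q)),
    gP (P, Q) (conj (faces_self P) (faces_self Q))).
  by move: E; rewrite (point_uniq (g _)) -(point_uniq (g (P, Q))) E' => -[].
apply/comb_classP/comb_equivP.
exists (fun=> point R), (fun=> P); split.
- by move=> F /uP ->; split=> //; exact: faces_self.
- by move=> G _; rewrite (point_uniq G); split=> //; exact: faces_self.
by move=> F G /uP -> /uP ->; split=> _ x.
Qed.

HB.instance Definition _ := Choice_isMonomialDef.Build comb_type
  comb_mulA comb_mul1r comb_mulr1 comb_mul_eq1.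
HB.instance Definition _ := MonomialDef_isConomialDef.Build comb_type comb_mulC.

End CombinatorialTypes.

(* The monoid algebra over the integers of the monoid of combinatorial types,
   i.e. the free abelian group on combinatorial types with the product
   extending the Cartesian product of polytopes. *)
Definition polyring (R : realType) : comNzRingType := malg (comb_type R) int.

Definition poly_class (R : realType) n (P : polytope R n) : polyring R :=
  mkmalgU (comb_class P) 1.

Section PolytopeRing.
Variable R : realType.

Lemma poly_classM n m (P : polytope R n) (Q : polytope R m) :
  poly_class P * poly_class Q = poly_class (polytope_prod P Q).
Proof. by rewrite /poly_class malgM_def fgmulUU mulr1 [mmul _ _]comb_mulE. Qed.

Lemma poly_class1 : poly_class (point R) = 1.
Proof. by []. Qed.

Lemma poly_classP n m (P : polytope R n) (Q : polytope R m) :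
  poly_class P = poly_class Q <-> comb_equiv P Q.
Proof.
split=> [E|/comb_classP PQ]; last by rewrite /poly_class PQ.
apply/comb_classP/eqP; have := congr1 (mcoeff (comb_class P)) E.
by rewrite !mcoeffU eqxx eq_sym; case: eqP.
Qed.

End PolytopeRing.

Section Associahedron.
Variables (R : realType) (n : nat).

(* Coordinates are indexed from 0, so x_i of the usual 1-based description is
   x 0 (i - 1). *)
Definition associahedron_set : set 'rV[R]_n.+1 :=
  [set x | \sum_i x 0 i = 3 ^+ n.+1 /\
     forall a b : 'I_n.+1, (a <= b)%N -> (a, b) != (ord0, ord_max) ->
       3 ^+ (b - a).+1 <= \sum_(i < n.+1 | (a <= i <= b)%N) x 0 i].

Lemma associahedron_neq0 : associahedron_set !=set0.
Proof.
pose S k : R := if k is 0%N then 0 else 3 ^+ k.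
exists (\row_i (S i.+1 - S i)); have sumE (a b : 'I_n.+1) : (a <= b)%N ->
    \sum_(i < n.+1 | (a <= i <= b)%N) (\row_i (S i.+1 - S i) : 'rV[R]_n.+1) 0 i
    = S b.+1 - S a.
  move=> ab; rewrite -(telescope_sumr S (leqW ab)) big_geq_mkord.
  rewrite (big_ord_widen_cond n.+1 (fun i => (a <= i)%N) (fun i => S i.+1 - S i))//.
  by apply: eq_bigr => i _; rewrite mxE.
split.
  transitivity (S (ord_max : 'I_n.+1).+1 - S (ord0 : 'I_n.+1)).
    by rewrite -sumE//; apply: eq_bigl => i; rewrite /= -ltnS ltn_ord.
  by rewrite /S subr0.
move=> a b ab _; rewrite sumE//; case: (val a) ab => [|k] kb /=; first by rewrite subr0 subn0.
have -> : b.+1 = (k.+1 + (b - k.+1).+1)%N by lia.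
rewrite exprD; set u := 3 ^+ k.+1; set v := 3 ^+ _.
have ge3 m : 3 <= (3 : R) ^+ m.+1 by rewrite exprS ler_peMr// exprn_ege1//; lra.
by have := ge3 k; have := ge3 (b - k.+1)%N; rewrite -/u -/v; nra.
Qed.

Lemma associahedron_bounded : is_bounded associahedron_set.
Proof.
exists (3 ^+ n.+1) => x i [xs xab].
have x0 j : 0 <= x 0 j.
  have [/= E|ne] := eqVneq (j, j) (ord0, ord_max).
    have [j0 n0] : j = ord0 /\ n = 0%N by case: E => ? /(congr1 val) /=; subst j.
    suff <- : \sum_i x 0 i = x 0 j by rewrite xs exprn_ge0.
    rewrite (big_pred1 j)// => k; apply/esym/eqP/val_inj.
    by rewrite j0 /=; have := ltn_ord k; rewrite {2}n0; case: (val k).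
  have := xab j j (leqnn _) ne; rewrite subnn (big_pred1 j); last first.
    by move=> k /=; rewrite -eqn_leq eq_sym.
  by apply: le_trans; rewrite exprn_ge0.
by rewrite ger0_norm// -xs (bigD1 i)//= lerDl sumr_ge0.
Qed.

Lemma associahedron_polyhedron : is_polyhedron associahedron_set.
Proof.
pose e (a b : 'I_n.+1) : 'rV[R]_n.+1 := \row_i (a <= i <= b)%N%:R.
have eE a b x : dotp (e a b) x = \sum_(i < n.+1 | (a <= i <= b)%N) x 0 i.
  rewrite big_mkcond; apply: eq_bigr => i _; rewrite mxE.
  by case: ifP; rewrite ?mul1r ?mul0r.
have e1 x : dotp (const_mx 1) x = \sum_i x 0 i :> R.
  by apply: eq_bigr => i _; rewrite mxE mul1r.
pose I := [seq ab : 'I_n.+1 * 'I_n.+1 <- enum {: 'I_n.+1 * 'I_n.+1} |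
            (ab.1 <= ab.2)%N && (ab != (ord0, ord_max))].
exists [:: (const_mx 1, 3 ^+ n.+1), (- const_mx 1, - 3 ^+ n.+1) &
        [seq (- e ab.1 ab.2, - 3 ^+ (ab.2 - ab.1).+1) | ab <- I]].
apply/seteqP; split=> x /=.
  move=> [xs xab] h; rewrite !inE => /or3P[/eqP->|/eqP->|/mapP[[a b]]] /=.
  - by rewrite e1 xs.
  - by rewrite dotpNl e1 xs.
  rewrite mem_filter => /andP[/andP[/= ab ne] _] -> /=.
  by rewrite dotpNl lerN2 eE; exact: xab.
move=> H; split.
  apply/eqP; rewrite eq_le -e1.
  have := H (const_mx 1, 3 ^+ n.+1); rewrite mem_head => -> //=.
  have := H (- const_mx 1, - 3 ^+ n.+1); rewrite !inE eqxx orbT dotpNl lerN2.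
  exact.
move=> a b ab ne; rewrite -eE -lerN2 -dotpNl.
apply: (H (- e a b, - 3 ^+ (b - a).+1)); rewrite !inE; apply/or3P/Or33.
apply/mapP; exists (a, b) => //.
by rewrite mem_filter ab ne mem_enum.
Qed.

(* The n-dimensional associahedron, of the path with n + 1 vertices: this is
   a_(n+1), not a_n. *)
Definition associahedron : polytope R n.+1 :=
  Polytope associahedron_neq0 associahedron_bounded associahedron_polyhedron.

End Associahedron.

(* associahedron R 0 is the point a_1. The set of faces is finite by finite_faces. *)
Definition motivic_interior (R : realType) n (P : polytope R n) : polyring R :=
  \sum_(F \in faces P) (- poly_class (associahedron R 0)) ^+ codim P F * poly_class F.

(* Formal power series in one variable, as sequences of coefficients. A record
   is used since functions already have a (pointwise) ring structure. *)
Record fps (A : comNzRingType) := Fps { fps_coef : nat -> A }.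

Section PowerSeries.
Variable A : comNzRingType.
Implicit Types f g h : fps A.

HB.instance Definition _ := gen_eqMixin (fps A).
HB.instance Definition _ := gen_choiceMixin (fps A).

Lemma fpsP f g : (forall n, fps_coef f n = fps_coef g n) <-> f = g.
Proof. by case: f g => [f] [g]; split=> [/funext /= ->|->]. Qed.

Definition fps_zero : fps A := Fps (fun=> 0).
Definition fps_opp f : fps A := Fps (fun n => - fps_coef f n).
Definition fps_add f g : fps A := Fps (fun n => fps_coef f n + fps_coef g n).
Definition fps_one : fps A := Fps (fun n => (n == 0%N)%:R).
Definition fps_mul f g : fps A :=
  Fps (fun n => \sum_(i < n.+1) fps_coef f i * fps_coef g (n - i)).

Lemma fps_addA : associative fps_add.
Proof. by move=> f g h; apply/fpsP => n /=; rewrite addrA. Qed.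

Lemma fps_addC : commutative fps_add.
Proof. by move=> f g; apply/fpsP => n /=; rewrite addrC. Qed.

Lemma fps_add0 : left_id fps_zero fps_add.
Proof. by move=> f; apply/fpsP => n /=; rewrite add0r. Qed.

Lemma fps_addN : left_inverse fps_zero fps_opp fps_add.
Proof. by move=> f; apply/fpsP => n /=; rewrite addNr. Qed.

HB.instance Definition _ := GRing.isZmodule.Build (fps A)
  fps_addA fps_addC fps_add0 fps_addN.

Definition fps_trunc n f : {poly A} := \poly_(i < n) fps_coef f i.

Lemma fps_mul_trunc n k f g : (k < n)%N ->
  fps_coef (fps_mul f g) k = (fps_trunc n f * fps_trunc n g)`_k.
Proof.
move=> kn; rewrite coefM; apply: eq_bigr => i _; rewrite !coef_poly.
by rewrite (leq_ltn_trans (leq_ord i) kn) (leq_ltn_trans (leq_subr i k) kn).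
Qed.

Lemma fps_mulC : commutative fps_mul.
Proof.
by move=> f g; apply/fpsP => n; rewrite !(@fps_mul_trunc n.+1)// mulrC.
Qed.

Lemma fps_mulA : associative fps_mul.
Proof.
move=> f g h; apply/fpsP => n; rewrite !(@fps_mul_trunc n.+1)//.
transitivity ((fps_trunc n.+1 f * (fps_trunc n.+1 g * fps_trunc n.+1 h))`_n).
  rewrite coefM [RHS]coefM; apply: eq_bigr => i _; congr (_ * _).
  by rewrite coef_poly ltnS leq_subr -fps_mul_trunc// ltnS leq_subr.
rewrite mulrA coefM [RHS]coefM; apply: eq_bigr => i _; congr (_ * _).
by rewrite [RHS]coef_poly ltn_ord -fps_mul_trunc// ltn_ord.
Qed.

Lemma fps_mul1 : left_id fps_one fps_mul.
Proof.
move=> f; apply/fpsP => n /=; rewrite big_ord_recl /= mul1r subn0.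
by rewrite big1 ?addr0// => i _; rewrite mul0r.
Qed.

Lemma fps_mulDl : left_distributive fps_mul fps_add.
Proof.
move=> f g h; apply/fpsP => n /=; rewrite -big_split.
by apply: eq_bigr => i _; rewrite mulrDl.
Qed.

Lemma fps_one_neq0 : fps_one != 0.
Proof.
apply/eqP => /fpsP /(_ 0%N) /= /eqP; exact/negP/oner_neq0.
Qed.

HB.instance Definition _ := GRing.Zmodule_isComNzRing.Build (fps A)
  fps_mulA fps_mulC fps_mul1 fps_mulDl fps_one_neq0.

Definition fpsX : fps A := Fps (fun n => (n == 1%N)%:R).

(* The composite f(g(x)), meaningful when g has zero constant term: the powers
   g ^+ k with k > n then do not contribute to the coefficient of x^n. *)
Definition fps_comp f g : fps A :=
  Fps (fun n => \sum_(k < n.+1) fps_coef f k * fps_coef (g ^+ k) n).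

End PowerSeries.

Definition assoc_alpha (R : realType) : fps (polyring R) :=
  fpsX _ + Fps (fun m => if m is n.+2 then poly_class (associahedron R n) else 0).

Definition assoc_beta (R : realType) : fps (polyring R) :=
  fpsX _ - Fps (fun m => if m is n.+2 then motivic_interior (associahedron R n) else 0).

(* Main.v *)
Require Import Defs.
From mathcomp Require Import all_boot all_order all_algebra.
From mathcomp Require Import all_classical all_reals.
From mathcomp Require Import finmap.
From mathcomp Require Import zify lra ring.

(* The faces of the associahedron with n + 1 leaves are indexed by the plane trees
   with n + 1 leaves in which every inner node has at least two children; such a
   tree is encoded as the laminar family of the leaf intervals of its inner nodes.
   The face poset of a face is the poset of refinements of its tree T, which
   factors along any subtree of T, so the class of the face is the product of the
   classes of the a_(c-1), with c running over the numbers of children of the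
   inner nodes. Its codimension is the number of inner nodes minus one. Hence
   beta is the generating series of trees weighted by (-1)^(number of inner
   nodes) times the class, and splitting off the root gives
   beta = x - sum_k a_k beta^(k+1), which says alpha(beta(x)) = x. *)

Set Implicit Arguments.
Unset Strict Implicit.
Unset Printing Implicit Defensive.

Import Order.TTheory GRing.Theory Num.Theory.

(** * Plane trees as laminar families *)

(** Everything rests on one binary operation, [graft]. The refinements of a graft are exactly the
    grafts of refinements, so its face poset is a product; node counts add up, so signs multiply;
    and a tree with a given node is a graft in exactly one way. To stay with this binary operation,
    the root is not split into all its children at once: the sums carry a second index [j], the
    number of initial leaves that are children of the root, and the child containing leaf [j] is
    pruned to a leaf, one child at a time. On the geometric side the obstacle is to see that every
    tree really occurs as a face. This needs a point at which precisely the inequalities of that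
    tree are tight; it is built by induction, joining two subtrees under a binary root and averaging
    two refinements otherwise. The same points separate the faces and make every added node lower
    the dimension, so that dimensions follow by counting steps in a chain. *)

Section Trees.
Local Open Scope fset_scope.
Local Open Scope nat_scope.

(** Disjoint leaf intervals correspond to coordinate blocks with at least one coordinate between
    them, so this is the usual compatibility of tubes: nested, or disjoint and not adjacent. *)
Definition compatible (s t : nat * nat) :=
  [|| s.2 < t.1, t.2 < s.1, (s.1 <= t.1) && (t.2 <= s.2)
    | (t.1 <= s.1) && (s.2 <= t.2)].

(* (a, b) is the inner node with leaves a, ..., b, i.e. the tube a + 1, ..., b of
   the path (coordinates a, ..., b - 1 of associahedron_set). *)
Definition bracketing n (T : {fset nat * nat}) :=
  [/\ forall a b, (a, b) \in T -> a < b <= n,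
      forall s t, s \in T -> t \in T -> compatible s t &
      0 < n -> (0, n) \in T].

(** Leaf [a] is replaced by the block [a, ..., a + m] and later leaves move by [m]. A left end at
    [a] goes to the first leaf of the block, a right end at [a] to the last one; hence the two
    different comparisons. *)
Definition graft_left a m c := if c <= a then c else c + m.
Definition graft_right a m d := if d < a then d else d + m.

(* Grafting the tree S at leaf a of the tree U; S has leaves 0, ..., m. *)
Definition graft a m (S U : {fset nat * nat}) : {fset nat * nat} :=
  [fset (a + t.1, a + t.2) | t in S] `|`
  [fset (graft_left a m t.1, graft_right a m t.2) | t in U].

Lemma graftP a m S U x y :
  reflect ((exists c d, [/\ (c, d) \in S, x = a + c & y = a + d]) \/
           (exists c d, [/\ (c, d) \in U, x = graft_left a m c &
                           y = graft_right a m d]))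
          ((x, y) \in graft a m S U).
Proof.
rewrite in_fsetU; apply: (iffP orP) => -[].
- by move=> /imfsetP[[c d] /= cd [-> ->]]; left; exists c, d.
- by move=> /imfsetP[[c d] /= cd [-> ->]]; right; exists c, d.
- by move=> [c [d [cd -> ->]]]; left; apply/imfsetP; exists (c, d).
- by move=> [c [d [cd -> ->]]]; right; apply/imfsetP; exists (c, d).
Qed.

Lemma bracketing_graft a m k S U : a <= k -> bracketing m S -> bracketing k U ->
  bracketing (k + m) (graft a m S U).
Proof.
move=> ak [Sr Sc Sm] [Ur Uc Uk]; rewrite /graft_left /graft_right; split.
- move=> x y /graftP[] [c [d [cd -> ->]]]; first by have := Sr _ _ cd; lia.
  by have := Ur _ _ cd; rewrite /graft_left /graft_right; do 2 case: ifP; lia.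
- move=> [x y] [x' y'] /graftP[] [c [d [cd -> ->]]] /graftP[]
    [c' [d' [cd' -> ->]]]; rewrite /compatible /=.
  + by have := Sc _ _ cd cd'; rewrite /compatible /=; lia.
  + have := Sr _ _ cd; have := Ur _ _ cd'.
    by rewrite /graft_left /graft_right; do 2 case: ifP; lia.
  + have := Sr _ _ cd'; have := Ur _ _ cd.
    by rewrite /graft_left /graft_right; do 2 case: ifP; lia.
  + have := Uc _ _ cd cd'; have := Ur _ _ cd; have := Ur _ _ cd'.
    by rewrite /compatible /= /graft_left /graft_right; do 4 case: ifP; lia.
- move=> km; apply/graftP; have [k0|k0] := posnP k.
    by left; exists 0, m; rewrite Sm; [split; lia|lia].
  right; exists 0, k; rewrite Uk// /graft_left /graft_right; split=> //.
  by case: ifP; lia.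
Qed.

(** The two parts can be read off the graft: translated nodes of [S] lie inside the block
    [a, ..., a + m], while the image of a node of [U] misses the block or contains it properly. *)
Lemma graft_sub a m k S U S' U' : bracketing m S -> bracketing k U ->
  bracketing m S' -> bracketing k U' ->
  (graft a m S U `<=` graft a m S' U') <-> S `<=` S' /\ U `<=` U'.
Proof.
move=> [Sr _ _] [Ur _ _] [Sr' _ _] [Ur' _ _]; split; last first.
  move=> [/fsubsetP SS /fsubsetP UU]; apply/fsubsetP => -[x y].
  move=> /graftP[] [c [d [cd -> ->]]]; apply/graftP.
    by left; exists c, d; rewrite SS.
  by right; exists c, d; rewrite UU.
move=> /fsubsetP H; split; apply/fsubsetP => -[c d] cd.
  have /graftP[] : (a + c, a + d) \in graft a m S' U'.
    by apply/H/graftP; left; exists c, d.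
    move=> [c' [d' [cd' cc dd]]].
    by have [-> ->] : c = c' /\ d = d' by lia.
  move=> [c' [d' [/Ur' + + +]]]; have := Sr _ _ cd.
  by rewrite /graft_left /graft_right; do 2 case: ifP; lia.
have /graftP[] : (graft_left a m c, graft_right a m d) \in graft a m S' U'.
  by apply/H/graftP; right; exists c, d.
  move=> [c' [d' [/Sr' + + +]]]; have := Ur _ _ cd.
  by rewrite /graft_left /graft_right; do 2 case: ifP; lia.
move=> [c' [d' [cd' cc dd]]].
suff [-> ->] : c = c' /\ d = d' by [].
by move: cc dd; rewrite /graft_left /graft_right; do 4 case: ifP; lia.
Qed.

Lemma graft_inj a m k S U S' U' : bracketing m S -> bracketing k U ->
  bracketing m S' -> bracketing k U' ->
  graft a m S U = graft a m S' U' -> S = S' /\ U = U'.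
Proof.
move=> bS bU bS' bU' E.
have [SS UU] : S `<=` S' /\ U `<=` U' by apply/(graft_sub a bS bU bS' bU'); rewrite E.
have [SS' UU'] : S' `<=` S /\ U' `<=` U by apply/(graft_sub a bS' bU' bS bU); rewrite E.
by split; apply/eqP; rewrite eqEfsubset ?SS ?UU.
Qed.

Lemma card_graft a m k S U : bracketing m S -> bracketing k U ->
  #|` graft a m S U| = #|` S| + #|` U|.
Proof.
move=> [Sr _ _] [Ur _ _]; rewrite /graft cardfsU.
rewrite [X in _ - #|` X|](_ : _ = fset0) ?cardfs0 ?subn0.
  congr addn; apply: card_imfset => -[c d] [c' d'] /= [].
    by move=> /addnI -> /addnI ->.
  move=> cc dd; congr pair; move: cc dd.
    by rewrite /graft_left; do 2 case: ifP; lia.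
  by rewrite /graft_right; do 2 case: ifP; lia.
apply/fsetP => -[x y]; rewrite in_fset0; apply/negbTE/negP.
rewrite in_fsetI => /andP[/imfsetP[[c d] /= /Sr cd [xc yd]]].
move=> /imfsetP[[c' d'] /= /Ur cd']; rewrite xc yd /graft_left /graft_right.
by case; do 2 case: ifP; lia.
Qed.

(* For m = 0 the node (a, a + m) is the leaf a. *)
Lemma graft_surj a m k T : a <= k -> bracketing (k + m) T ->
  (0 < m -> (a, a + m) \in T) ->
  exists S U, [/\ bracketing m S, bracketing k U & T = graft a m S U].
Proof.
move=> ak [Tr Tc Tkm] Tm.
have Ta c d : (c, d) \in T ->
    [|| d < a, a + m < c, (a <= c) && (d <= a + m) | (c <= a) && (a + m <= d)].
  move=> cd; have [m0|m0] := posnP m; first by have := Tr _ _ cd; lia.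
  by have := Tc _ _ cd (Tm m0); rewrite /compatible /=; lia.
pose inside (t : nat * nat) := (a <= t.1) && (t.2 <= a + m).
pose S := [fset (t.1 - a, t.2 - a) | t in [fset t in T | inside t]].
pose U := [fset (if t.1 <= a then t.1 else t.1 - m,
                 if t.2 < a then t.2 else t.2 - m)
          | t in [fset t in T | ~~ inside t]].
have SP c d : (c, d) \in S -> (a + c, a + d) \in T /\ c < d <= m.
  move=> /imfsetP[[c' d']]; rewrite !inE /inside /= => /andP[cd' i] [-> ->].
  by have r := Tr _ _ cd'; rewrite !subnKC; [split=> //|..]; lia.
have UP c d : (c, d) \in U ->
    (graft_left a m c, graft_right a m d) \in T /\ c < d <= k.
  move=> /imfsetP[[c' d']]; rewrite !inE /inside /= => /andP[cd' i] [-> ->].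
  have := Tr _ _ cd'; have := Ta _ _ cd'; rewrite /graft_left /graft_right => tc tr.
  split; last by do 2 case: ifP; lia.
  rewrite [if _ then _ else _](_ : _ = c'); last by do 2 case: ifP; lia.
  by rewrite [if _ then _ else _](_ : _ = d')//; do 2 case: ifP; lia.
exists S, U; split.
- split=> [c d /SP[]//|[c d] [c' d'] /SP[cd _] /SP[cd' _]|m0].
    by have := Tc _ _ cd cd'; rewrite /compatible /=; lia.
  apply/imfsetP; exists (a, a + m); last by rewrite /= subnn addKn.
  by rewrite !inE /inside /= Tm// !leqnn.
- split=> [c d /UP[]//|[c d] [c' d'] /UP[cd r] /UP[cd' r']|k0].
    have := Tc _ _ cd cd'; rewrite /compatible /= /graft_left /graft_right.
    by do 4 case: ifP; lia.
  apply/imfsetP; exists (0, k + m); last first.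
    by rewrite /= ltnNge (leq_trans ak (leq_addr _ _)) /= addnK.
  rewrite !inE /inside /= Tkm; lia.
- apply/fsetP => -[x y]; apply/idP/graftP => [xy|].
    have := Tr _ _ xy; have := Ta _ _ xy => tc tr.
    have [i|i] := boolP (inside (x, y)).
      left; exists (x - a), (y - a); move: (i); rewrite /inside /= => i'.
      split; [|lia|lia]; apply/imfsetP; exists (x, y) => //.
      by rewrite !inE xy i.
    right; exists (if x <= a then x else x - m), (if y < a then y else y - m).
    move: (i); rewrite /inside /= => i'.
    split; first by apply/imfsetP; exists (x, y) => //; rewrite !inE xy i.
      by rewrite /graft_left; do 2 case: ifP; lia.
    by rewrite /graft_right; do 2 case: ifP; lia.
  move=> [] [c [d [cd -> ->]]]; first by have [] := SP _ _ cd.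
  by have [] := UP _ _ cd.
Qed.

Lemma bracketing0 T : bracketing 0 T <-> T = fset0.
Proof.
split=> [[Tr _ _]|->]; last by split=> // [a b|[a b]]; rewrite in_fset0.
by apply/fsetP => -[a b]; rewrite in_fset0; apply/negbTE/negP => /Tr; lia.
Qed.

Lemma bracketing_sub n T T' : bracketing n T' -> T `<=` T' ->
  (0 < n -> (0, n) \in T) -> bracketing n T.
Proof.
move=> [Tr Tc _] /fsubsetP TT Tn; split=> // [a b /TT /Tr//|s t /TT s' /TT].
exact: Tc.
Qed.

Definition corolla n : {fset nat * nat} := if n is 0 then fset0 else [fset (0, n)].

Lemma in_corolla n t : (t \in corolla n) = (0 < n) && (t == (0, n)).
Proof. by case: n => [|n] /=; rewrite ?in_fset0 ?in_fset1. Qed.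

Lemma bracketing_corolla n : bracketing n (corolla n).
Proof.
split=> [a b|s t|n0]; rewrite ?in_corolla ?n0 ?eqxx//.
  by move=> /andP[n0 /eqP[-> ->]]; rewrite n0 leqnn.
by move=> /andP[_ /eqP->] /andP[_ /eqP->]; rewrite /compatible !leqnn !orbT.
Qed.

Lemma corolla_sub n T : bracketing n T -> corolla n `<=` T.
Proof.
move=> [_ _ Tn]; apply/fsubsetP => t; rewrite in_corolla.
by move=> /andP[n0 /eqP->]; exact: Tn.
Qed.

Lemma bracketing1 T : bracketing 1 T -> T = corolla 1.
Proof.
move=> bT; apply/eqP; rewrite eqEfsubset corolla_sub// andbT.
have [Tr _ _] := bT; apply/fsubsetP => -[a b] /Tr ab; rewrite in_corolla /=.
by apply/eqP; congr pair; lia.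
Qed.

(* The tree whose root has the two subtrees S (with leaves 0, ..., s) and U
   (with r + 1 leaves). *)
Definition join_trees s r S U := graft 0 s S (graft 1 r U (corolla 1)).

Lemma bracketing_join s r S U : bracketing s S -> bracketing r U ->
  bracketing (1 + r + s) (join_trees s r S U).
Proof.
move=> bS bU; apply: bracketing_graft => //; apply: bracketing_graft => //.
exact: bracketing_corolla.
Qed.

Lemma card_join s r S U : bracketing s S -> bracketing r U ->
  #|` join_trees s r S U| = (#|` S| + #|` U|).+1.
Proof.
move=> bS bU; rewrite /join_trees (card_graft 0 bS (k := 1 + r)).
  by rewrite (card_graft 1 bU (bracketing_corolla 1)) /= cardfs1 addn1 addnS.
exact: bracketing_graft (bracketing_corolla 1).
Qed.

Lemma join_treesP s r S U x y :
  reflect [\/ (x, y) \in S, x = 0 /\ y = 1 + r + s |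
             exists c d, [/\ (c, d) \in U, x = s.+1 + c & y = s.+1 + d]]
          ((x, y) \in join_trees s r S U).
Proof.
apply: (iffP (graftP _ _ _ _ _ _)) => [[]|[]].
- by move=> [c [d [cd -> ->]]]; constructor 1.
- move=> [c [d [/graftP[] [c' [d' [cd' -> ->]]] -> ->]]].
    constructor 3; exists c', d'.
    rewrite /graft_left /graft_right (_ : 1 + c' <= 0 = false)//=.
    by split=> //; lia.
  move: cd'; rewrite in_corolla /= => /eqP[-> ->]; constructor 2.
  by rewrite /graft_left /graft_right /=; lia.
- by move=> xy; left; exists x, y.
- move=> [-> ->]; right; exists 0, (1 + r); split=> //; apply/graftP; right.
  by exists 0, 1; rewrite in_corolla eqxx.
- move=> [c [d [cd -> ->]]]; right; exists (1 + c), (1 + d).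
  rewrite /graft_left /graft_right (_ : 1 + c <= 0 = false)//=.
  split; [|lia|lia]; by apply/graftP; left; exists c, d.
Qed.

Lemma root_split s r T : bracketing (1 + r + s) T ->
  (0 < s -> (0, s) \in T) -> (0 < r -> (s.+1, 1 + r + s) \in T) ->
  exists S U, [/\ bracketing s S, bracketing r U & T = join_trees s r S U].
Proof.
move=> bT Ts Tr.
have [S [V [bS bV TE]]] := graft_surj (leq0n (1 + r)) bT Ts.
have Vr : 0 < r -> (1, 1 + r) \in V.
  move=> r0; have := Tr r0; rewrite TE => /graftP[].
    by move=> [c [d [/[dup] cd]]]; have [+ _ _] := bS => /[apply]; lia.
  move=> [c [d [cd]]]; rewrite /graft_left /graft_right /=.
  case: ifP => c0 e1 e2; first by have [Vr _ _] := bV; have := Vr _ _ cd; lia.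
  by move: cd; rewrite (_ : c = 1) 1?(_ : d = 1 + r)//; lia.
have [U [W [bU bW VE]]] := graft_surj (leqnn 1) bV Vr.
by exists S, U; split=> //; rewrite TE VE (bracketing1 bW).
Qed.

Definition box n : {fset nat * nat} :=
  [fset t in [seq (i, j) | i <- iota 0 n.+1, j <- iota 0 n.+1] | t.1 < t.2].

Lemma in_box n a b : ((a, b) \in box n) = (a < b <= n).
Proof.
rewrite in_fset; have -> : a < b <= n =
    ((a, b) \in [seq (i, j) | i <- iota 0 n.+1, j <- iota 0 n.+1]) && (a < b).
  apply/idP/andP => [ab|[/allpairsPdep[i [j []]]]].
    by split; [apply/allpairsPdep; exists a, b; rewrite !mem_iota; split=> //|]; lia.
  by rewrite !mem_iota => _ jn [E E']; lia.
by [].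
Qed.

Lemma bracketing_fset1U n T a b : bracketing n T -> a < b <= n ->
  (forall t, t \in T -> compatible (a, b) t) -> bracketing n ((a, b) |` T).
Proof.
move=> [Tr Tc Tn] ab abT; split=> [c d|s t|n0].
- by rewrite in_fset1U => /predU1P[[-> ->]//|/Tr].
- rewrite !in_fset1U => /predU1P[->|sT] /predU1P[->|tT].
  + by rewrite /compatible !leqnn !orbT.
  + exact: abT.
  + by have := abT _ sT; rewrite /compatible; lia.
  + exact: Tc.
- by rewrite in_fset1U Tn// orbT.
Qed.

(* In the last case the root has at least three children; u groups the first two
   of them and w groups all but the first. *)
Lemma bracketing_ind (P : nat -> {fset nat * nat} -> Prop) :
  P 0 fset0 ->
  (forall s r S U, bracketing s S -> bracketing r U -> P s S -> P r U ->
    P (1 + r + s) (join_trees s r S U)) ->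
  (forall n T u w, bracketing n T -> u != w ->
    bracketing n (u |` T) -> bracketing n (w |` T) ->
    P n (u |` T) -> P n (w |` T) -> P n T) ->
  forall n T, bracketing n T -> P n T.
Proof.
move=> P0 Pjoin Pflip n; have [N] := ubnP n; elim: N n => // N IHn n nN T.
(* The grouping case adds nodes and keeps [n], so at fixed [n] the induction runs on the number of
   intervals not yet in [T]. *)
have [k] := ubnP #|` box n `\` T|; elim: k T => // k IHT T kT bT.
have [n0|n0] := posnP n; first by move: bT; rewrite n0 => /bracketing0->.
have [Tr Tc Tn] := bT.
(* The maximal [m] is the last leaf of the first child of the root, 0 if that child is a leaf. If
   the second child ends at [n], the root is binary; otherwise [p] below is the last leaf of the
   second child, and [(0, p)] and [(m.+1, n)] are the two groupings. *)
pose Q b := (b < n) && ((b == 0) || ((0, b) \in T)).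
have Q0 : Q 0 by rewrite /Q n0.
have [m /andP[mn m0] mmax] := ex_maxnP (ex_intro (fun b => is_true (Q b)) 0 Q0)
  (fun b (Qb : Q b) => ltnW (andP Qb).1).
have [last_child|] := boolP ((m.+1 == n) || ((m.+1, n) \in T)).
  have nE : n = 1 + (n - m.+1) + m by lia.
  have [|||S [U [bS bU TE]]] := @root_split m (n - m.+1) T; rewrite -?nE//.
  - by case/orP: m0 => [/eqP->|].
  - by case/orP: last_child => [/eqP|//]; lia.
  by rewrite TE {1}nE; apply: Pjoin => //; apply: IHn => //; lia.
rewrite negb_or => /andP[mn' wT].
have {}mn : m.+1 < n by lia.
pose Q' b := (b < n) && ((b == m.+1) || ((m.+1, b) \in T)).
have Q'm : Q' m.+1 by rewrite /Q' mn eqxx.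
have [p /andP[pn p0] pmax] := ex_maxnP (ex_intro (fun b => is_true (Q' b)) _ Q'm)
  (fun b (Qb : Q' b) => ltnW (andP Qb).1).
have mp := pmax _ Q'm.
have Tw a b : (a, b) \in T -> [|| b <= m, m < a | (a == 0) && (b == n)].
  move=> ab; have r := Tr _ _ ab; case/predU1P: m0 => [m0|m0].
    have [a0|] := posnP a; last lia.
    have [bn|] := ltnP b n; last lia.
    by have := mmax b; rewrite /Q bn -a0 ab orbT => /(_ isT); lia.
  have := Tc _ _ m0 ab; rewrite /compatible /= => c.
  have [a0|] := posnP a; last lia.
  have [bn|] := ltnP b n; last lia.
  by have := mmax b; rewrite /Q bn -a0 ab orbT => /(_ isT); lia.
have Tu a b : (a, b) \in T -> [|| b <= p, p < a | (a == 0) && (b == n)].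
  move=> ab; have r := Tr _ _ ab; have := Tw _ _ ab.
  have [am|] := eqVneq a m.+1; last first.
    case/predU1P: p0 => [p0|p0]; first lia.
    by have := Tc _ _ p0 ab; rewrite /compatible /=; lia.
  have [bn|] := ltnP b n; last first.
    by move=> bn; have := ab; rewrite am (_ : b = n) ?(negbTE wT)//; lia.
  by have := pmax b; rewrite /Q' bn -am ab orbT => /(_ isT); lia.
have bu : bracketing n ((0, p) |` T).
  apply: bracketing_fset1U => //; first lia.
  by move=> [a b] ab; have := Tu _ _ ab; have := Tr _ _ ab; rewrite /compatible /=; lia.
have bw : bracketing n ((m.+1, n) |` T).
  apply: bracketing_fset1U => //; first lia.
  by move=> [a b] ab; have := Tw _ _ ab; have := Tr _ _ ab; rewrite /compatible /=; lia.
have uT : (0, p) \notin T.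
  by apply/negP => up; have := mmax p; rewrite /Q pn up orbT => /(_ isT); lia.
have smaller a b : (a, b) \notin T -> a < b <= n -> #|` box n `\` ((a, b) |` T)| < k.
  move=> abT ab; rewrite -ltnS; apply: leq_trans kT.
  rewrite [X in _ < X.+1](cardfsD1 (a, b)).
  rewrite in_fsetD abT in_box ab/= ltnS add1n; apply: fsubset_leq_card.
  apply/fsubsetP => t; rewrite !inE negb_or -andbA => /and3P[-> -> ->].
  by [].
apply: (Pflip n T (0, p) (m.+1, n)) => //.
- by apply: IHT => //; apply: smaller => //; lia.
- by apply: IHT => //; apply: smaller => //; lia.
Qed.

(** The refinement built is a binary tree: each join adds one node, which makes [n] in total, and
    for a larger root any refinement grouping the first two children is taken. It supplies the lower
    bound in the dimension count. *)
Lemma bracketing_extend n T : bracketing n T ->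
  exists T', [/\ bracketing n T', T `<=` T' & n <= #|` T'|].
Proof.
move: n T; apply: bracketing_ind.
- by exists fset0; split=> //; apply/bracketing0.
- move=> s r S U bS bU [S' [bS' SS Ss]] [U' [bU' UU Ur]].
  exists (join_trees s r S' U'); split; first exact: bracketing_join.
    apply/fsubsetP => -[x y] /join_treesP xy; apply/join_treesP.
    case: xy => [xy|xy|[c [d [cd -> ->]]]].
    - by constructor 1; exact: (fsubsetP SS).
    - by constructor 2.
    - by constructor 3; exists c, d; split=> //; exact: (fsubsetP UU).
  by rewrite card_join//; lia.
- move=> n T u w _ _ _ _ [T' [bT' TT Tn]] _; exists T'; split=> //.
  exact: fsubset_trans (fsubsetU1 _ _) TT.
Qed.

End Trees.

Local Open Scope fset_scope.
Local Open Scope classical_set_scope.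
Local Open Scope ring_scope.

(** * Faces of the associahedron *)

Section BracketSets.
Variable R : realType.
Implicit Types (n : nat) (T : {fset nat * nat}) (t : nat * nat).

Definition seg n (x : 'rV[R]_n) t : R := dotp (\row_i (t.1 <= i < t.2)%N%:R) x.

Definition pow3 t : R := 3 ^+ (t.2 - t.1).

(** The interval [(0, n)] belongs to [box n], although the associahedron has no inequality for it;
    for a tree with [n > 0] the root makes it an equality, which fixes the coordinate sum. *)
Definition bracket_set n T : set 'rV[R]_n :=
  [set x | (forall t, t \in box n -> pow3 t <= seg x t) /\
           (forall t, t \in T -> seg x t = pow3 t)].

Arguments bracket_set : clear implicits.

Lemma segE n (x : 'rV[R]_n) a b :
  seg x (a, b) = \sum_(i < n | (a <= i < b)%N) x 0 i.
Proof.
rewrite /seg /dotp [RHS]big_mkcond; apply: eq_bigr => i _; rewrite mxE /=.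
by case: ifP; rewrite ?mul1r ?mul0r.
Qed.

Lemma seg_cat n (x : 'rV[R]_n) a b c : (a <= b <= c)%N ->
  seg x (a, c) = seg x (a, b) + seg x (b, c).
Proof.
move=> abc; rewrite !segE (bigID (fun i : 'I_n => (i < b)%N)) /=.
by congr (_ + _); apply: eq_bigl => i; lia.
Qed.

Lemma seg_nil n (x : 'rV[R]_n) a : seg x (a, a) = 0.
Proof. by rewrite segE big1// => i; lia. Qed.

Lemma seg1 n (x : 'rV[R]_n) (i : 'I_n) : seg x (i : nat, i.+1) = x 0 i.
Proof.
rewrite segE (big_pred1 i)// => j; apply/idP/eqP => [ij|->]; last by rewrite leqnn ltnSn.
by apply/val_inj => /=; lia.
Qed.

Lemma seg_diff n (y : nat -> R) a b : (a <= b <= n)%N ->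
  seg (\row_(i < n) (y i.+1 - y i)) (a, b) = y b - y a.
Proof.
move=> /andP[ab bn]; rewrite segE -(telescope_sumr y ab) big_geq_mkord.
rewrite (big_ord_widen_cond n (fun i => (a <= i)%N) (fun i => y i.+1 - y i))//.
by apply: eq_bigr => i _; rewrite mxE.
Qed.

Lemma seg_ge0 n (x : 'rV[R]_n) a b : (forall t, t \in box n -> pow3 t <= seg x t) ->
  (a <= b <= n)%N -> 0 <= seg x (a, b).
Proof.
move=> xP /andP[ab bn]; have [->|ab'] := eqVneq a b; first by rewrite seg_nil.
by apply: le_trans (xP _ _); [exact: exprn_ge0|rewrite in_box; lia].
Qed.

Lemma pow3_ge3 k : (0 < k)%N -> 3 <= 3 ^+ k :> R.
Proof. by case: k => // k _; rewrite exprS ler_peMr// exprn_ege1//; lra. Qed.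

Lemma pow3_mono k m : (k <= m)%N -> 3 ^+ k <= 3 ^+ m :> R.
Proof. by move=> km; apply: ler_weXn2l => //; lra. Qed.

(* Supermodularity: two crossing tight tubes would violate the inequality of their
   union. *)
Lemma tight_compatible n (x : 'rV[R]_n) s t :
  (forall t, t \in box n -> pow3 t <= seg x t) ->
  s \in box n -> t \in box n -> seg x s = pow3 s -> seg x t = pow3 t ->
  compatible s t.
Proof.
move=> xP.
(* The case [c = b] of adjacent blocks is included. With [u], [v], [w] the powers of 3 of the three
   pieces, tightness would give [u v w <= u v + v w], impossible for [u, w >= 3]. Base 2 would not
   do: [u = w = 2] gives equality. *)
have crossing a b c d : (a < c)%N -> (c <= b)%N -> (b < d)%N -> (d <= n)%N ->
    seg x (a, b) = pow3 (a, b) -> seg x (c, d) = pow3 (c, d) -> False.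
  move=> ac cb bd dn; have ad : pow3 (a, d) <= seg x (a, d).
    by apply: xP; rewrite in_box; lia.
  have cb0 : 0 <= seg x (c, b) by apply: seg_ge0 => //; lia.
  move: ad; rewrite (@seg_cat _ x a c d) ?(@seg_cat _ x a c b); [|lia..].
  rewrite /pow3 /= (_ : d - a = (c - a) + (b - c) + (d - b))%N; last lia.
  rewrite (_ : b - a = (c - a) + (b - c))%N; last lia.
  rewrite (_ : d - c = (b - c) + (d - b))%N; last lia.
  rewrite !exprD; have := @pow3_ge3 (c - a); have := @pow3_ge3 (d - b).
  rewrite !subn_gt0 => /(_ bd) + /(_ ac).
  have : 0 < 3 ^+ (b - c) :> R by rewrite exprn_gt0.
  set u := 3 ^+ (c - a); set v := 3 ^+ (b - c); set w := 3 ^+ (d - b).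
  move=> v0 u3 w3 ad ab cd.
  have : 0 <= v * ((u - 2) * (w - 2)) by rewrite mulr_ge0 ?ltW// mulr_gt0; lra.
  by nra.
case: s t => [a b] [c d]; rewrite !in_box => ab cd sE tE.
apply/negPn/negP; rewrite /compatible /= => N.
have [ac|ca] := ltnP a c; first by apply: (crossing a b c d) => //; lia.
by apply: (crossing c d a b) => //; lia.
Qed.

(* y is the sequence of partial sums of a point whose tight inequalities are
   exactly those of T; in the last case of bracketing_ind, the midpoint of the two
   given points works. *)
Lemma generic_heights n T : bracketing n T -> exists y : nat -> R,
  forall a b, (a < b <= n)%N ->
    pow3 (a, b) <= y b - y a /\ (y b - y a = pow3 (a, b) <-> (a, b) \in T).
Proof.
move: n T; apply: bracketing_ind => [|s r S U bS bU [y yP] [z zP]|n T u w bT uw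
  bu bw [y yP] [z zP]].
- by exists (fun=> 0) => a b; lia.
- have endpoint k (V : {fset nat * nat}) (v : nat -> R) : bracketing k V ->
      (forall a b, (a < b <= k)%N -> pow3 (a, b) <= v b - v a /\
         (v b - v a = pow3 (a, b) <-> (a, b) \in V)) ->
      v k - v 0%N = if k is 0 then 0 else 3 ^+ k.
    case: k => [|k] [_ _ Vk] vP; first by rewrite subrr.
    have [|_ [_ vE]] := vP 0%N k.+1; first exact: leqnn.
    by rewrite vE ?Vk// /pow3 subn0.
  have ys := endpoint _ _ _ bS yP; have zr := endpoint _ _ _ bU zP.
  have le_last k (V : {fset nat * nat}) (v : nat -> R) i j :
      (forall a b, (a < b <= k)%N -> pow3 (a, b) <= v b - v a /\
         (v b - v a = pow3 (a, b) <-> (a, b) \in V)) -> (i <= j <= k)%N ->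
      v i <= v j.
    move=> vP ij; have [->//|ij'] := eqVneq i j.
    have [|p _] := vP i j; first lia.
    by rewrite -subr_ge0; apply: le_trans p; exact: exprn_ge0.
  (* The heights of [S] start at 0 and those of [U] are shifted to end at [3 ^+ (1 + r + s)]; the
     remaining coordinate [s], between the two blocks, absorbs the difference. *)
  exists (fun i => if (i <= s)%N then y i - y 0%N
                   else 3 ^+ (1 + r + s) + (z (i - s.+1)%N - z r)) => a b abn.
  have [Sr _ _] := bS; have [Ur _ _] := bU.
  have [bs|sb] := leqP b s.
    have as' : (a <= s)%N by lia.
    rewrite as' opprB addrA subrK; have [|? yab] := yP a b; first lia.
    split=> //; rewrite yab; split=> [ab|/join_treesP[//|[]|[c [d []]]]].
    - by apply/join_treesP; constructor 1.
    - lia.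
    - lia.
  have [as'|sa] := leqP a s; last first.
    have -> : 3 ^+ (1 + r + s) + (z (b - s.+1)%N - z r) -
      (3 ^+ (1 + r + s) + (z (a - s.+1)%N - z r)) =
      z (b - s.+1)%N - z (a - s.+1)%N by lra.
    have [|] := zP (a - s.+1)%N (b - s.+1)%N; first lia.
    rewrite /pow3 /= (_ : b - s.+1 - (a - s.+1) = b - a)%N; last lia.
    move=> ? ->; split=> //; split=> [ab|/join_treesP[/Sr|[]|[c [d []]]]].
    - apply/join_treesP; constructor 3.
      by exists (a - s.+1)%N, (b - s.+1)%N; split=> //; lia.
    - lia.
    - lia.
    - by move=> cd -> ->; rewrite !addKn.
  have [E|ne] := eqVneq (a, b) (0%N, 1 + r + s)%N.
    case: E => -> ->; rewrite (_ : 1 + r + s - s.+1 = r)%N; last lia.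
    rewrite !subrr subr0 addr0 /pow3 subn0; split=> //; split=> // _.
    by apply/join_treesP; constructor 2.
  have abN : (a, b) \notin join_trees s r S U.
    apply/negP => /join_treesP[/Sr|[a0 b0]|[c [d []]]]; [lia| |lia].
    by move: ne; rewrite a0 b0 eqxx.
  (* An interval across the gap, other than the root, must be slack. Its sum falls short of the
     total [3 ^+ (1 + r + s)] by at most the two subtree totals, together at most [3 ^+ (r + s)].
     This leaves at least twice [3 ^+ (r + s)], while [b - a <= r + s]. *)
  suff lt : pow3 (a, b) <
      3 ^+ (1 + r + s) + (z (b - s.+1)%N - z r) - (y a - y 0%N).
    split; first exact: ltW.
    by rewrite (negbTE abN); split=> // E; move: lt; rewrite E ltxx.
  have ya : y a <= y s by apply: (le_last _ _ _ _ _ yP); lia.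
  have zb : z 0%N <= z (b - s.+1)%N by apply: (le_last _ _ _ _ _ zP); lia.
  apply: (@le_lt_trans _ _ (3 ^+ (r + s))).
    by apply: pow3_mono => /=; move: ne; rewrite xpair_eqE negb_and; lia.
  suff : (y s - y 0%N) + (z r - z 0%N) <= 3 ^+ (r + s).
    have : 0 < 3 ^+ (r + s) :> R by rewrite exprn_gt0.
    by rewrite -addnA add1n exprS; lra.
  rewrite ys zr exprD.
  case: (s) => [|s']; case: (r) => [|r']; rewrite ?expr0 ?mulr1 ?mul1r; try lra.
  by have := @pow3_ge3 s'.+1 isT; have := @pow3_ge3 r'.+1 isT; nra.
- exists (fun i => (y i + z i) / 2) => a b ab.
  have [y1 y2] := yP a b ab; have [z1 z2] := zP a b ab; split; first lra.
  split=> [E|abT].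
    have /y2 : y b - y a = pow3 (a, b) by lra.
    have /z2 : z b - z a = pow3 (a, b) by lra.
    rewrite !in_fset1U => /predU1P[->|//]; rewrite eq_sym (negbTE uw).
    by [].
  have : y b - y a = pow3 (a, b) by apply/y2; rewrite in_fset1U abT orbT.
  have : z b - z a = pow3 (a, b) by apply/z2; rewrite in_fset1U abT orbT.
  by lra.
Qed.

(** Such a point makes [T] recoverable from its face, and witnesses that a further node cuts out a
    strictly smaller face. *)
Lemma generic_point n T : bracketing n T -> exists2 x : 'rV[R]_n,
  bracket_set n T x & forall t, t \in box n -> seg x t = pow3 t -> t \in T.
Proof.
move=> bT; have [y yP] := generic_heights bT; have [Tr _ _] := bT.
exists (\row_(i < n) (y i.+1 - y i)); first split.
- move=> [a b]; rewrite in_box => ab; rewrite seg_diff; last lia.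
  by have [] := yP _ _ ab.
- move=> [a b] /[dup] /Tr ab abT; rewrite seg_diff; last lia.
  by apply/(yP _ _ ab).2.
- move=> [a b]; rewrite in_box => ab; rewrite seg_diff; last lia.
  by move=> /(yP _ _ ab).2.
Qed.

Definition mid n (x y : 'rV[R]_n) := 2^-1 *: x + 2^-1 *: y.

Lemma seg_mid n (x y : 'rV[R]_n) t : seg (mid x y) t = (seg x t + seg y t) / 2.
Proof. by rewrite /seg dotpDr !dotpZr; lra. Qed.

Definition tubes n (A : set 'rV[R]_n) : {fset nat * nat} :=
  [fset t in box n | `[< forall x, A x -> seg x t = pow3 t >]].

Lemma tubesP n (A : set 'rV[R]_n) t :
  t \in tubes A <-> t \in box n /\ forall x, A x -> seg x t = pow3 t.
Proof.
rewrite !inE /=; split=> [/andP[tn /asboolP]//|[tn tP]].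
by rewrite tn; apply/asboolP.
Qed.

(** Each interval outside [tubes A] is slack somewhere on [A]; taking the midpoint with such a point
    makes it slack and keeps slack whatever already was. *)
Lemma relative_interior_point n (A : set 'rV[R]_n) : A !=set0 ->
  (forall x y, A x -> A y -> A (mid x y)) -> A `<=` bracket_set n fset0 ->
  exists2 x, A x & forall t, t \in box n -> t \notin tubes A -> pow3 t < seg x t.
Proof.
move=> [x0 Ax0] Amid Ale.
suff H (s : seq (nat * nat)) : {subset s <= box n} ->
    exists2 x, A x & forall t, t \in s -> t \notin tubes A -> pow3 t < seg x t.
  by have [x Ax xP] := H (box n) (fun _ => id); exists x.
elim: s => [_|t s IH sub]; first by exists x0.
have [u us|x Ax xP] := IH; first by apply: sub; rewrite inE us orbT.
have tn : t \in box n by apply: sub; rewrite mem_head.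
have [tA|tA] := boolP (t \in tubes A).
  by exists x => // u; rewrite inE => /predU1P[->|/xP//]; rewrite tA.
have /existsNP[z /not_implyP[Az zt]] : ~ forall x, A x -> seg x t = pow3 t.
  by move=> tP; move/negP: tA; apply; apply/tubesP.
exists (mid x z); first exact: Amid.
move=> u; rewrite inE seg_mid => us uA.
have un : u \in box n by case/predU1P: us => [->//|us]; apply: sub; rewrite inE us orbT.
have [x1 _] := Ale _ Ax; have xu := x1 u un.
have [z1 _] := Ale _ Az; have zu := z1 u un.
case/predU1P: us => [ut|/xP /(_ uA)]; last lra.
rewrite ut in xu zu *; have : pow3 t < seg z t by rewrite lt_neqAle zu andbT eq_sym; apply/eqP.
by lra.
Qed.

Lemma argmax_mid n (c : 'rV[R]_n) (A : set 'rV[R]_n) :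
  (forall x y, A x -> A y -> A (mid x y)) ->
  forall x y, argmax c A x -> argmax c A y -> argmax c A (mid x y).
Proof.
move=> Amid x y [Ax mx] [Ay my]; split; first exact: Amid.
by move=> z Az; rewrite dotpDr !dotpZr; have := mx z Az; have := my z Az; lra.
Qed.

Lemma bracket_set_mid n T (x y : 'rV[R]_n) :
  bracket_set n T x -> bracket_set n T y -> bracket_set n T (mid x y).
Proof.
move=> [x1 x2] [y1 y2]; split=> t tP; rewrite seg_mid.
  by have := x1 _ tP; have := y1 _ tP; lra.
by rewrite x2// y2//; lra.
Qed.

Lemma bracket_set_anti n T T' : (T `<=` T')%fset -> bracket_set n T' `<=` bracket_set n T.
Proof. by move=> /fsubsetP TT x [x1 x2]; split=> // t /TT; exact: x2. Qed.

Lemma small_step (s : seq (nat * nat)) (m w : nat * nat -> R) :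
  (forall t, t \in s -> 0 < m t) ->
  exists2 e : R, 0 < e & forall t, t \in s -> e * `|w t| <= m t.
Proof.
elim: s => [_|u s IH sP]; first by exists 1.
have [t ts|e e0 eP] := IH; first by apply: sP; rewrite inE ts orbT.
have w1 : 0 < 1 + `|w u| by rewrite ltr_pwDl.
have u0 : 0 < m u by apply: sP; rewrite mem_head.
exists (Num.min e (m u / (1 + `|w u|))); first by rewrite lt_min e0 divr_gt0.
move=> t; rewrite inE => /predU1P[->|ts].
  apply: le_trans (_ : m u / (1 + `|w u|) * `|w u| <= _).
    by rewrite ler_wpM2r// ge_min lexx orbT.
  by rewrite mulrAC ler_pdivrMr// ler_wpM2l ?ltW// ltrDr.
by apply: le_trans (eP _ ts); rewrite ler_wpM2r// ge_min lexx.
Qed.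

(** Let [x] be a relative interior point of the face and [z] any point with the same tight
    intervals. The segment from [z] to [x] extends a little beyond [x] inside the polytope;
    maximality at [x] then forbids [dotp c z < dotp c x]. *)
Lemma argmax_bracket_set n T (c : 'rV[R]_n) :
  (T `<=` box n)%fset -> argmax c (bracket_set n T) !=set0 ->
  let T' := tubes (argmax c (bracket_set n T)) in
  argmax c (bracket_set n T) = bracket_set n T'.
Proof.
move=> Tn; set A := argmax c _ => A0 T'.
have AT : A `<=` bracket_set n T by move=> x [].
have TT' : (T `<=` T')%fset.
  by apply/fsubsetP => t tT; apply/tubesP; split=> [|x /AT[_ ->]//]; exact: (fsubsetP Tn).
apply/seteqP; split=> [x Ax|z zP].
  by have [x1 x2] := AT _ Ax; split=> // t /tubesP[_]; exact.
have [x Ax xP] := relative_interior_point A0 (argmax_mid (@bracket_set_mid n T))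
  (subset_trans AT (@bracket_set_anti n fset0 T (fsub0set _))).
have [t|e e0 eP] := @small_step [seq t <- box n | t \notin T']
    (fun t => seg x t - pow3 t) (fun t => seg x t - seg z t).
  by rewrite mem_filter subr_gt0 => /andP[tT' tn]; exact: xP.
have [Tx mx] := Ax; have [z1 z2] := zP.
have Tz : bracket_set n T z by apply: bracket_set_anti zP.
split=> // y Ty; apply: le_trans (mx _ Ty) _.
have : bracket_set n T (x + e *: (x - z)).
  have stepE t : seg (x + e *: (x - z)) t = seg x t + e * (seg x t - seg z t).
    by rewrite /seg dotpDr dotpZr dotpBr.
  have tight t : t \in T' -> seg (x + e *: (x - z)) t = pow3 t.
    move=> tT'; have [_ tA] := (tubesP _ _).1 tT'.
    by rewrite stepE z2// tA// subrr mulr0 addr0.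
  split=> t tT; last by apply: tight; exact: (fsubsetP TT').
  have [/tight->//|tT'] := boolP (t \in T').
  rewrite stepE; have := eP t; rewrite mem_filter tT' tT => /(_ isT).
  have := ler_norm (- (seg x t - seg z t)); rewrite normrN.
  by move: `|_| => N wN; have : e * - (seg x t - seg z t) <= e * N; [rewrite ler_wpM2l// ltW|lra].
move=> /mx; rewrite dotpDr dotpZr dotpBr gerDl pmulr_rle0// subr_le0.
exact.
Qed.

Lemma tubes_bracket_set n T : bracketing n T -> tubes (bracket_set n T) = T.
Proof.
move=> bT; have [x xT xP] := generic_point bT; have [Tr _ _] := bT.
apply/fsetP => t; apply/idP/idP => [/tubesP[tn /(_ _ xT)]|tT]; first exact: xP.
by apply/tubesP; case: t tT => a b tT; rewrite in_box; split=> [|y [_ ->]//]; exact: Tr.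
Qed.

Lemma bracketing_box n T : bracketing n T -> (T `<=` box n)%fset.
Proof. by move=> [Tr _ _]; apply/fsubsetP => -[a b] /Tr; rewrite in_box. Qed.

(** A single point of the face already forces its tight intervals to be pairwise compatible, through
    [tight_compatible]; so every face yields a tree. *)
Lemma bracketing_tubes n T (c : 'rV[R]_n) : bracketing n T ->
  argmax c (bracket_set n T) !=set0 ->
  bracketing n (tubes (argmax c (bracket_set n T))) /\
  (T `<=` tubes (argmax c (bracket_set n T)))%fset.
Proof.
move=> bT; set A := argmax c _ => A0.
have AT : A `<=` bracket_set n T by move=> x [].
have TA : (T `<=` tubes A)%fset.
  apply/fsubsetP => t tT; apply/tubesP; split=> [|x /AT[_ ->]//].
  exact: (fsubsetP (bracketing_box bT)).
have [x0 Ax0] := A0; have [x1 _] := AT _ Ax0.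
split=> //; split=> [a b /tubesP[]|s t /tubesP[sn sA] /tubesP[tn tA]|n0].
- by rewrite in_box.
- by apply: (tight_compatible x1) => //; [exact: sA|exact: tA].
- by have [_ _ Tn] := bT; exact: (fsubsetP TA _ (Tn n0)).
Qed.

Lemma bracket_set_subset n T T' : bracketing n T -> bracketing n T' ->
  bracket_set n T `<=` bracket_set n T' <-> (T' `<=` T)%fset.
Proof.
move=> bT bT'; split=> [TT'|]; last exact: bracket_set_anti.
rewrite -(tubes_bracket_set bT) -(tubes_bracket_set bT').
by apply/fsubsetP => t /tubesP[tn tT']; apply/tubesP; split=> // x /TT'; exact: tT'.
Qed.

(** Take for [c] minus the sum of the normals of the nodes of [T']. Each [seg x t] is at least
    [pow3 t], so the sum is minimal exactly when all nodes of [T'] are tight, and [generic_point]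
    shows that this minimum is reached. *)
Lemma bracket_set_argmax n T T' : bracketing n T -> bracketing n T' ->
  (T `<=` T')%fset -> exists c, bracket_set n T' = argmax c (bracket_set n T).
Proof.
move=> bT bT' TT'.
pose c : 'rV[R]_n := - \sum_(t <- T') \row_i (t.1 <= i < t.2)%N%:R.
have cE x : dotp c x = - \sum_(t <- T') seg x t.
  rewrite dotpNl; congr (- _); rewrite /dotp /seg exchange_big.
  by apply: eq_bigr => i _; rewrite summxE mulr_suml.
have [x0 x0P] : exists x0, bracket_set n T' x0 by have [x] := generic_point bT'; exists x.
have leT' x : bracket_set n T x -> forall t, t \in T' -> pow3 t <= seg x t.
  by move=> [x1 _] t tT'; apply: x1; exact: (fsubsetP (bracketing_box bT')).
exists c; apply/seteqP; split=> [x xT'|x [xT mx]].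
  split=> [|y /leT' yT]; first exact: bracket_set_anti xT'.
  rewrite !cE lerN2 big_seq [leRHS]big_seq; apply: ler_sum => t tT'.
  by have [_ ->] := xT'; rewrite ?yT.
have := mx _ (bracket_set_anti TT' x0P); rewrite !cE lerN2 => le.
split=> [|t tT']; first by have [] := xT.
apply/eqP; rewrite eq_le leT'// andbT.
move: le; rewrite !(big_fsetD1 t tT') /= (x0P.2 _ tT') => le.
have : \sum_(u <- (T' `\ t)%fset) seg x0 u <= \sum_(u <- (T' `\ t)%fset) seg x u.
  rewrite big_seq [leRHS]big_seq; apply: ler_sum => u; rewrite in_fsetD1 => /andP[_ uT'].
  by rewrite (x0P.2 _ uT'); exact: leT'.
by lra.
Qed.

End BracketSets.

Arguments bracket_set : clear implicits.
Arguments pow3 : clear implicits.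

(** * Polytopes of trees: face posets, products and dimensions *)

Section BracketPolytopes.
Variable R : realType.
Implicit Types (n : nat) (T : {fset nat * nat}).

Section Def.
Variables (n : nat) (T : {fset nat * nat}).
Hypothesis bT : bracketing n T.

Lemma bracket_set_neq0 : bracket_set R n T !=set0.
Proof. by have [x] := generic_point R bT; exists x. Qed.

Lemma bracket_set_bounded : is_bounded (bracket_set R n T).
Proof.
exists (3 ^+ n) => x i [x1 x2]; have i0 := ltn_ord i.
have seg0 a b : (a <= b <= n)%N -> 0 <= seg x (a, b) by exact: seg_ge0.
have : seg x (0%N, n) = 3 ^+ n.
  by rewrite x2 /pow3 ?subn0//; have [_ _] := bT; apply; lia.
rewrite (@seg_cat _ _ x 0 i n) ?(@seg_cat _ _ x i i.+1 n) ?seg1; [|lia..].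
have := seg0 0%N i; have := seg0 i.+1 n; have := seg0 i i.+1; rewrite seg1.
rewrite !leq0n leqnn leqnSn i0 ltnW// => /(_ isT) xi /(_ isT) ? /(_ isT) ? ?.
by rewrite ger0_norm//; lra.
Qed.

Lemma bracket_set_polyhedron : is_polyhedron (bracket_set R n T).
Proof.
pose v (t : nat * nat) : 'rV[R]_n := \row_i (t.1 <= i < t.2)%N%:R.
exists ([seq (- v t, - pow3 R t) | t <- box n] ++ [seq (v t, pow3 R t) | t <- T]).
apply/seteqP; split=> [x [x1 x2] h|x xP].
  rewrite mem_cat => /orP[] /mapP[t tP ->] /=.
    by rewrite dotpNl lerN2; exact: x1.
  by have := x2 t tP; rewrite /seg => ->.
have x1 t : t \in box n -> pow3 R t <= seg x t.
  move=> tn; rewrite -lerN2 -dotpNl; apply: (xP (_, _)).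
  by rewrite mem_cat; apply/orP; left; apply/mapP; exists t.
split=> // t tT; apply/eqP; rewrite eq_le x1 ?andbT; last first.
  exact: (fsubsetP (bracketing_box bT)).
apply: (xP (_, _)).
by rewrite mem_cat; apply/orP; right; apply/mapP; exists t.
Qed.

Definition bracket_polytope : polytope R n :=
  Polytope bracket_set_neq0 bracket_set_bounded bracket_set_polyhedron.

End Def.

(* The face of the associahedron indexed by the tree T; junk if T is not a tree. *)
Definition tree_face n T : polytope R n :=
  if pselect (bracketing n T) is left bT then bracket_polytope bT
  else bracket_polytope (bracketing_corolla n).

Lemma tree_faceE n T : bracketing n T -> pset (tree_face n T) = bracket_set R n T.
Proof. by rewrite /tree_face; case: pselect. Qed.

Lemma tree_face_tubes n T F : bracketing n T -> faces (tree_face n T) F ->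
  [/\ bracketing n (tubes F), (T `<=` tubes F)%fset & F = tree_face n (tubes F)].
Proof.
move=> bT [c Fc]; rewrite (tree_faceE bT) in Fc.
have F0 : argmax c (bracket_set R n T) !=set0 by rewrite -Fc; exact: polytope_neq0.
have [bF TF] := bracketing_tubes bT F0.
rewrite Fc; split=> //; apply: polytope_inj; rewrite tree_faceE// Fc.
by apply: argmax_bracket_set => //; exact: bracketing_box.
Qed.

Lemma tree_face_face n T T' : bracketing n T -> bracketing n T' ->
  (T `<=` T')%fset -> faces (tree_face n T) (tree_face n T').
Proof.
move=> bT bT' /(bracket_set_argmax R bT bT')[c cE].
by exists c; rewrite !tree_faceE.
Qed.

(** More nodes mean more equalities and a smaller face, whence the reversed inclusion on the side of
    trees. *)
Lemma tree_face_iso n T : bracketing n T ->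
  poset_iso (faces (tree_face n T)) (fun F G => pset F `<=` pset G)
            [set T' | bracketing n T' /\ (T `<=` T')%fset] (fun A B => B `<=` A)%fset.
Proof.
move=> bT; exists (fun F => tubes F), (tree_face n); split.
- by move=> F /(tree_face_tubes bT)[].
- move=> T' [bT' TT']; split; first exact: tree_face_face.
  by rewrite tree_faceE// tubes_bracket_set.
move=> F G /(tree_face_tubes bT)[bF _ FE] /(tree_face_tubes bT)[bG _ GE].
by rewrite {1}FE {1}GE !tree_faceE//; exact: bracket_set_subset.
Qed.

(** Every refinement of the graft still contains the root of [S], moved to [(a, a + m)], so
    [graft_surj] splits it into refinements of [S] and [U]. The face posets therefore agree, and
    combinatorial equivalence sees only these. *)
Lemma tree_face_graft a m k S U : (a <= k)%N -> bracketing m S -> bracketing k U ->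
  comb_equiv (tree_face (k + m) (graft a m S U))
             (polytope_prod (tree_face m S) (tree_face k U)).
Proof.
move=> ak bS bU; apply/comb_equivP.
have bT := bracketing_graft ak bS bU.
apply: poset_iso_trans (tree_face_iso bT) _; apply: poset_iso_sym.
apply: poset_iso_trans (faces_prod_iso _ _) _.
apply: poset_iso_trans (poset_iso_prod (tree_face_iso bS) (tree_face_iso bU)) _.
pose up n T := [set T' | bracketing n T' /\ (T `<=` T')%fset].
pose g (SU : {fset nat * nat} * {fset nat * nat}) := graft a m SU.1 SU.2.
have gP T : up (k + m)%N (graft a m S U) T ->
    exists SU, (up m S `*` up k U) SU /\ g SU = T.
  move=> [bT' TT]; have [m0|S' [U' [bS' bU' TE]]] := graft_surj ak bT'.
    apply/(fsubsetP TT)/graftP; left; exists 0%N, m; rewrite addn0.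
    by split=> //; have [_ _] := bS; exact.
  exists (S', U'); split=> //; move: TT; rewrite TE => /(graft_sub a bS bU bS' bU').
  by move=> [].
pose f T := xget (S, U) [set SU | (up m S `*` up k U) SU /\ g SU = T].
have fP T : up (k + m)%N (graft a m S U) T -> (up m S `*` up k U) (f T) /\ g (f T) = T.
  move=> /gP[SU SUT].
  exact: (@xgetPex _ _ [set SU | (up m S `*` up k U) SU /\ g SU = T]) (ex_intro _ SU SUT).
have gup SU : (up m S `*` up k U) SU -> up (k + m)%N (graft a m S U) (g SU).
  move=> [[b1 s1] [b2 s2]]; split; first exact: bracketing_graft.
  exact/(graft_sub a bS bU b1 b2).
exists g, f; split=> [SU SUP|T /fP//|[S1 U1] [S2 U2] [[b1 _] [b2 _]] [[b3 _] [b4 _]]].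
  split; first exact: gup.
  have [[[b1 _] [b2 _]]] := fP _ (gup _ SUP); have [[b3 _] [b4 _]] := SUP.
  move=> /(graft_inj b1 b2 b3 b4); case: (f _) SUP => [? ?] _ /=.
  by case: (SU) => [? ?] /= [-> ->].
by apply: iff_sym; exact: (graft_sub a b3 b4 b1 b2).
Qed.

Section AffineDimension.

Lemma affdim_attained n (A : set 'rV[R]_n) : A !=set0 ->
  exists p (q : 'I_(affdim A) -> 'rV[R]_n),
    [/\ A p, forall i, A (q i) & row_free (\matrix_i (q i - p))].
Proof.
move=> [x Ax].
pose P (k : 'I_n.+1) := `[< exists (p : 'rV[R]_n) (q : 'I_k -> 'rV[R]_n),
  [/\ A p, forall i, A (q i) & row_free (\matrix_i (q i - p))] >].
have P0 : P ord0.
  apply/asboolP; exists x, (fun=> x); split=> //.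
  by rewrite /row_free eqn_leq rank_leq_row.
have Pgt0 : (0 < #|P|)%N by apply/card_gt0P; exists ord0.
have [k Pk E] := eq_bigmax_cond (@nat_of_ord n.+1) Pgt0.
by rewrite /affdim E; exact/asboolP.
Qed.

Lemma affdim_ge n k (A : set 'rV[R]_n) p (q : 'I_k -> 'rV[R]_n) :
  A p -> (forall i, A (q i)) -> row_free (\matrix_i (q i - p)) -> (k <= affdim A)%N.
Proof.
move=> Ap Aq free; have kn : (k < n.+1)%N.
  by move: free; rewrite ltnS /row_free => /eqP <-; exact: rank_leq_col.
rewrite -[k]/(nat_of_ord (Ordinal kn)); apply: leq_bigmax_cond.
by apply/asboolP; exists p, q.
Qed.

(** Since [b] lies off a hyperplane containing [A], it can be appended to a maximal affinely
    independent family of [A]: pairing a linear relation with [c] kills every term but that of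
    [b]. *)
Lemma affdim_lt n (c : 'rV[R]_n) v (A B : set 'rV[R]_n) b : A !=set0 ->
  A `<=` B -> (forall x, A x -> dotp c x = v) -> B b -> dotp c b != v ->
  (affdim A < affdim B)%N.
Proof.
move=> /affdim_attained[p [q [Ap Aq free]]] AB Av Bb bv.
pose q' (i : 'I_(affdim A).+1) := if unlift ord0 i is Some j then q j else b.
apply: (@affdim_ge _ _ _ p q'); first exact: AB.
  by move=> i; rewrite /q'; case: unlift => [j|//]; exact: AB.
apply: inj_row_free => u uM.
have uE : u 0 ord0 *: (b - p) + \sum_i u 0 (lift ord0 i) *: (q i - p) = 0.
  rewrite -[RHS]uM mulmx_sum_row big_ord_recl rowK /q' unlift_none; congr (_ + _).
  by apply: eq_bigr => i _; rewrite rowK liftK.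
have u0 : u 0 ord0 = 0.
  have sum0 (r : seq 'I_(affdim A)) :
      dotp c (\sum_(i <- r) u 0 (lift ord0 i) *: (q i - p)) = 0.
    elim: r => [|i r IH]; first by rewrite big_nil -(scale0r 0) dotpZr mul0r.
    by rewrite big_cons dotpDr IH dotpZr dotpBr !Av// subrr mulr0 addr0.
  have := congr1 (dotp c) uE; rewrite dotpDr sum0 dotpZr dotpBr (Av p)// addr0.
  rewrite -(scale0r (0 : 'rV[R]_n)) dotpZr mul0r => /eqP.
  by rewrite mulf_eq0 subr_eq0 (negbTE bv) orbF => /eqP.
pose u' : 'rV[R]_(affdim A) := \row_i u 0 (lift ord0 i).
have : u' *m \matrix_i (q i - p) = 0.
  rewrite -[RHS]uE u0 scale0r add0r mulmx_sum_row.
  by apply: eq_bigr => i _; rewrite rowK mxE.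
move=> /eqP; rewrite mulmx_free_eq0// => /eqP u'0.
apply/rowP => i; rewrite mxE; case: (unliftP ord0 i) => [j ->|->//].
by have := congr1 (fun w : 'rV_(affdim A) => w 0 j) u'0; rewrite !mxE.
Qed.

Lemma affdim_hyperplane n (c : 'rV[R]_n) v (A : set 'rV[R]_n) : A !=set0 ->
  c != 0 -> (forall x, A x -> dotp c x = v) -> (affdim A < n)%N.
Proof.
move=> /affdim_attained[p [q [Ap Aq /eqP free]]] c0 Av.
have : (\matrix_i (q i - p) *m c^T) = 0.
  apply/matrixP => i j; rewrite ord1 !mxE.
  transitivity (dotp c (q i - p)); last by rewrite dotpBr !Av// subrr.
  by apply: eq_bigr => k _; rewrite !mxE mulrC.
move=> /mulmx0_rank_max; rewrite free; apply: leq_trans.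
by rewrite -addn1 leq_add2l lt0n mxrank_eq0 trmx_eq0.
Qed.

End AffineDimension.

Lemma affdim_tree_face_lt n T t : bracketing n T -> bracketing n (t |` T)%fset ->
  t \notin T -> (affdim (tree_face n (t |` T)%fset) < affdim (tree_face n T))%N.
Proof.
move=> bT btT tT; rewrite !tree_faceE//.
have [x xT xt] := generic_point R bT; have tn : t \in box n.
  by apply: (fsubsetP (bracketing_box btT)); rewrite fset1U1.
apply: (@affdim_lt _ (\row_i (t.1 <= i < t.2)%N%:R) (pow3 R t) _ _ x) => //.
- exact: bracket_set_neq0.
- exact: bracket_set_anti (fsubsetU1 _ _).
- by move=> y [_]; apply; rewrite fset1U1.
- by apply: contra tT => /eqP; exact: xt.
Qed.

Lemma affdim_tree_face_add n T T' : bracketing n T -> bracketing n T' ->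
  (T `<=` T')%fset ->
  (affdim (tree_face n T') + #|` T'| <= affdim (tree_face n T) + #|` T|)%N.
Proof.
move=> bT bT' TT'; have [k] := ubnP #|` (T' `\` T)%fset|.
elim: k T bT TT' => // k IH T bT TT' Tk.
have [/eqP D0|[t]] := fset_0Vmem (T' `\` T)%fset.
  have -> : T = T' by apply/eqP; rewrite eqEfsubset TT' -fsetD_eq0.
  by [].
rewrite in_fsetD => /andP[tT tT'].
have tTT' : (t |` T `<=` T')%fset by rewrite fsubUset fsub1set tT'.
have btT : bracketing n (t |` T)%fset.
  apply: bracketing_sub bT' tTT' _ => n0; rewrite in_fset1U orbC.
  by have [_ _ ->] := bT.
have := affdim_tree_face_lt bT btT tT.
have := IH _ btT tTT'; rewrite cardfsU1 tT add1n addnS => H lt.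
apply: leq_trans (H _) _; last by rewrite -addSn leq_add2r.
rewrite -ltnS; apply: leq_trans Tk; rewrite ltnS; apply: fproper_ltn_card.
rewrite fproperE; apply/andP; split.
  by apply/fsubsetP => u; rewrite !inE negb_or -andbA => /and3P[_ -> ->].
apply/fsubsetPn; exists t; first by rewrite in_fsetD tT.
by rewrite !inE eqxx.
Qed.

(* Adding nodes one at a time to the corolla until T, and to T until there are n of
   them, strictly decreases the dimension at each step. *)
Lemma affdim_tree_face n T : (0 < n)%N -> bracketing n T ->
  (affdim (tree_face n T) + #|` T| = n)%N.
Proof.
move=> n0 bT; apply/eqP; rewrite eqn_leq; apply/andP; split.
  apply: leq_trans (affdim_tree_face_add (bracketing_corolla n) bT (corolla_sub bT)) _.
  have -> : #|` corolla n| = 1%N by case: (n) n0 => // k _; rewrite cardfs1.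
  rewrite addn1.
  apply: (@affdim_hyperplane _ (\row_i (0 <= i < n)%N%:R) (pow3 R (0%N, n))).
  - exact: polytope_neq0.
  - apply/eqP => /rowP /(_ (Ordinal n0)); rewrite !mxE /= n0 => /eqP.
    exact/negP/oner_neq0.
  - move=> x; rewrite (tree_faceE (bracketing_corolla n)) => -[_ /(_ (0%N, n))].
    by apply; rewrite in_corolla n0 eqxx.
have [T' [bT' TT' nT']] := bracketing_extend bT.
by apply: leq_trans (affdim_tree_face_add bT bT' TT'); rewrite (leq_trans nT')// leq_addl.
Qed.

Lemma pset_associahedron n :
  pset (associahedron R n) = bracket_set R n.+1 (corolla n.+1).
Proof.
have segS (x : 'rV[R]_n.+1) (a b : 'I_n.+1) :
    \sum_(i < n.+1 | (a <= i <= b)%N) x 0 i = seg x (a : nat, b.+1) by rewrite segE.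
have total (x : 'rV[R]_n.+1) : \sum_i x 0 i = seg x (0%N, n.+1).
  by rewrite segE; apply: eq_bigl => i; rewrite ltn_ord.
apply/seteqP; split=> x [].
  rewrite total => x1 x2; split=> [[a b]|t].
    rewrite in_box => ab; have [E|ne] := eqVneq (a, b) (0%N, n.+1).
      by case: E => -> ->; rewrite x1.
    have an : (a < n.+1)%N by lia.
    (* The associahedron is described by inclusive coordinate ranges, so the half-open [(a, b)]
       corresponds to first coordinate [a] and last coordinate [b.-1]. *)
    have bn : (b.-1 < n.+1)%N by lia.
    have bE : b.-1.+1 = b by lia.
    have := x2 (Ordinal an) (Ordinal bn); rewrite segS /= bE /pow3 /=.
    rewrite -subSn ?bE; last lia.
    apply; first lia.
    by apply: contra ne => /eqP[a0 b0]; apply/eqP; congr pair; lia.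
  by rewrite in_corolla => /= /eqP->.
move=> x1 x2; split; first by rewrite total x2// in_corolla eqxx.
move=> a b ab _; rewrite segS.
have := x1 (a : nat, b.+1); rewrite in_box /pow3 /= subSn//; apply.
by have := ltn_ord b; lia.
Qed.

End BracketPolytopes.

(** * Composition of power series *)

Section PowerSeriesComposition.
Variable A : comNzRingType.
Implicit Types f g h : fps A.

Lemma fps_coefM f g n :
  fps_coef (f * g) n = \sum_(i < n.+1) fps_coef f i * fps_coef g (n - i).
Proof. by []. Qed.

(** The hypotheses say that [f] is x times [g], so its k-th power is x^k times that of [g]. This
    links the series indexed by number of leaves with the one indexed by that number minus one. *)
Lemma fps_coef_shiftX f g : fps_coef f 0 = 0 ->
  (forall n, fps_coef f n.+1 = fps_coef g n) ->
  forall k n, fps_coef (f ^+ k) n = if (k <= n)%N then fps_coef (g ^+ k) (n - k) else 0.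
Proof.
move=> f0 fS; elim=> [n|k IH n]; first by rewrite !expr0 subn0.
rewrite !exprS fps_coefM big_ord_recl f0 mul0r add0r.
case: n => [|n]; first by rewrite big_ord0.
rewrite ltnS subSS; have [kn|nk] := leqP k n; last first.
  by apply: big1 => i _; rewrite lift0 IH ifF ?mulr0//; lia.
rewrite fps_coefM (big_ord_widen n.+1
  (fun i => fps_coef g i * fps_coef (g ^+ k) (n - k - i)))//; last by rewrite ltnS leq_subr.
rewrite [RHS]big_mkcond; apply: eq_bigr => i _.
have i_lt := ltn_ord i; rewrite lift0 fS IH subSS (_ : (k <= n - i)%N = (i < (n - k).+1)%N); last lia.
by case: ifP; rewrite ?mulr0// subnAC.
Qed.

Lemma fps_coefX_small f k n : fps_coef f 0 = 0 -> (n < k)%N ->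
  fps_coef (f ^+ k) n = 0.
Proof.
move=> f0 nk; rewrite (fps_coef_shiftX (g := Fps (fun i => fps_coef f i.+1)))//.
by rewrite leqNgt nk.
Qed.

Lemma fps_coefX_diag f n : fps_coef f 0 = 0 -> fps_coef f 1 = 1 ->
  fps_coef (f ^+ n) n = 1.
Proof.
move=> f0 f1; rewrite (fps_coef_shiftX (g := Fps (fun i => fps_coef f i.+1)))//.
rewrite leqnn subnn; elim: n => // n IH.
by rewrite exprS fps_coefM big_ord_recl big_ord0 /= IH f1 mulr1 addr0.
Qed.

Lemma fps_comp_widen f g n N : fps_coef g 0 = 0 -> (n < N)%N ->
  fps_coef (fps_comp f g) n = \sum_(k < N) fps_coef f k * fps_coef (g ^+ k) n.
Proof.
move=> g0 nN; rewrite /= (big_ord_widen N (fun k => fps_coef f k * fps_coef (g ^+ k) n))//.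
rewrite big_mkcond; apply: eq_bigr => k _; case: ltnP => // nk.
by rewrite fps_coefX_small ?mulr0.
Qed.

(** Both sides are the sum over [i, j <= n] of [f_i g_j] times the coefficient of x^n in
    [h ^+ (i + j)]; pairs with [i + j > n] contribute 0 because [h] has no constant term. *)
Lemma fps_compM f g h : fps_coef h 0 = 0 ->
  fps_comp (f * g) h = fps_comp f h * fps_comp g h.
Proof.
move=> h0; apply/fpsP => n; rewrite fps_coefM.
transitivity (\sum_(i < n.+1) \sum_(j < n.+1)
    fps_coef f i * fps_coef g j * fps_coef (h ^+ (i + j)) n); last first.
  under [RHS]eq_bigr => p _.
    have pn := ltn_ord p.
    rewrite (@fps_comp_widen f h p n.+1)// (@fps_comp_widen g h (n - p) n.+1)//; last first.
      by rewrite ltnS leq_subr.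
    rewrite big_distrlr /=; over.
  rewrite [RHS]exchange_big /=; apply: eq_bigr => i _.
  rewrite [RHS]exchange_big /=; apply: eq_bigr => j _.
  by rewrite exprD fps_coefM mulr_sumr; apply: eq_bigr => p _; ring.
rewrite /=; under eq_bigr => k _.
  rewrite (big_ord_widen n.+1 (fun i => fps_coef f i * fps_coef g (k - i)))//.
  rewrite big_mkcond mulr_suml /=; over.
rewrite exchange_big /=; apply: eq_bigr => i _.
rewrite -(big_mkord xpredT (fun k => (if (i < k.+1)%N then
  fps_coef f i * fps_coef g (k - i) else 0) * fps_coef (h ^+ k) n)).
rewrite -(big_mkord xpredT (fun j =>
  fps_coef f i * fps_coef g j * fps_coef (h ^+ (i + j)) n)).
have i_le : (i <= n.+1)%N by apply: ltnW.
rewrite (big_cat_nat (n := i))//= big_nat big1 ?add0r => [|k ki]; last first.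
  by rewrite ifF ?mul0r//; lia.
rewrite -{1}[nat_of_ord i]add0n big_addn.
rewrite [RHS](big_cat_nat (n := (n.+1 - i)%N))//= ?leq_subr//.
rewrite [X in _ = _ + X]big_nat [X in _ = _ + X]big1 ?addr0 => [|j ji]; last first.
  by rewrite fps_coefX_small ?mulr0//; lia.
by apply: eq_bigr => j _; rewrite ifT ?addnK 1?addnC//; lia.
Qed.

Lemma fps_comp_exp f h k : fps_coef h 0 = 0 ->
  fps_comp (f ^+ k) h = fps_comp f h ^+ k.
Proof.
move=> h0; elim: k => [|k IH]; last by rewrite !exprS fps_compM// IH.
apply/fpsP => n; rewrite !expr0 /= big_ord_recl big1 => [|i _].
  by rewrite mul1r addr0.
by rewrite mul0r.
Qed.

Lemma fps_compA f g h : fps_coef g 0 = 0 -> fps_coef h 0 = 0 ->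
  fps_comp (fps_comp f g) h = fps_comp f (fps_comp g h).
Proof.
move=> g0 h0; apply/fpsP => n /=.
under [RHS]eq_bigr => k _ do rewrite -fps_comp_exp// /= mulr_sumr.
under eq_bigr => k _.
  have kn := ltn_ord k.
  have := @fps_comp_widen f g k n.+1 g0 kn; rewrite /= => ->.
  rewrite mulr_suml; over.
rewrite exchange_big; apply: eq_bigr => k _; apply: eq_bigr => i _.
by rewrite /= mulrA.
Qed.

Lemma fps_comp_Xl f : fps_coef f 0 = 0 -> fps_comp (fpsX A) f = f.
Proof.
move=> f0; apply/fpsP => -[|n] /=.
  by rewrite big_ord_recl big_ord0 mul0r addr0 f0.
rewrite !big_ord_recl /= big1 => [|i _]; last by rewrite mul0r.
by rewrite mul0r add0r mul1r expr1 addr0.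
Qed.

Lemma fps_comp_Xr f : fps_comp f (fpsX A) = f.
Proof.
apply/fpsP => n /=; have X0 : fps_coef (fpsX A) 0 = 0 by [].
have XS k : fps_coef (fpsX A) k.+1 = fps_coef 1 k by [].
rewrite (bigD1 ord_max)//= fps_coefX_diag// mulr1 big1 ?addr0// => k kn.
rewrite (fps_coef_shiftX X0 XS) expr1n; case: leqP => _; last by rewrite mulr0.
have {}kn : (k < n)%N by rewrite ltn_neqAle -ltnS ltn_ord andbT; exact: kn.
by rewrite /= subn_eq0 leqNgt kn mulr0.
Qed.

(** Triangularity: the coefficient of x^n in the composite is that of [f] plus a combination of
    earlier coefficients of [f], as [h ^+ n] has coefficient 1 at x^n. *)
Lemma fps_comp_inj h : fps_coef h 0 = 0 -> fps_coef h 1 = 1 ->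
  injective (fun f => fps_comp f h).
Proof.
move=> h0 h1 f g /fpsP fg; apply/fpsP => n; have [N] := ubnP n.
elim: N n => // N IH n nN; have := fg n; rewrite /= !big_ord_recr /=.
rewrite fps_coefX_diag// !mulr1; under eq_bigr => i _.
  rewrite IH; last exact: leq_trans (ltn_ord i) nN.
  over.
by move/addrI.
Qed.

(* Both g o f and X become g after composing with g on the right. *)
Lemma fps_comp_invC f g : fps_coef f 0 = 0 -> fps_coef g 0 = 0 ->
  fps_coef g 1 = 1 -> fps_comp f g = fpsX A -> fps_comp g f = fpsX A.
Proof.
move=> f0 g0 g1 fg; apply: (fps_comp_inj g0 g1).
by rewrite fps_compA// fg fps_comp_Xr fps_comp_Xl.
Qed.

End PowerSeriesComposition.

(* Applied to c n j summing over the trees with n + 1 leaves in which the first j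
   leaves are children of the root; in the conclusion the root has k + 1 children. *)
Lemma recurrence_coef (A : comNzRingType) (c : nat -> nat -> A) (a : nat -> A) :
  (forall n, (0 < n)%N -> c n n.+1 = - a n) ->
  (forall n j, (0 < n)%N -> (j <= n)%N -> c n j =
     \sum_(m < n.+1 | (m < n)%N && (j + m <= n)%N) c m 0%N * c (n - m)%N j.+1) ->
  forall n j, (0 < n)%N -> (j <= n.+1)%N ->
  c n j = - \sum_(k < n.+1 | (0 < k)%N && (j <= k.+1)%N)
    a k * fps_coef (Fps (fun n => c n 0%N) ^+ (k.+1 - j)) (n - k).
Proof.
move=> c_last c_rec n j; set b := Fps _.
have [N] := ubnP (n.+1 - j); elim: N n j => // N IH n j jN n0.
rewrite leq_eqVlt => /predU1P[->|]; last rewrite ltnS => jn.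
  rewrite c_last// (big_pred1 ord_max) => [|k].
    by rewrite subnn subnn expr0 mulr1.
  by apply/idP/eqP => [kn|->/=]; [apply: val_inj|]; have := ltn_ord k; move=> /=; lia.
rewrite c_rec//.
transitivity (- \sum_(m < n.+1 | (m < n)%N && (j + m <= n)%N)
    \sum_(k < n.+1 | [&& (0 < k)%N, (j <= k)%N & (k <= n - m)%N])
      a k *
      (fps_coef b m * fps_coef (b ^+ (k - j)) (n - k - m))).
  rewrite -sumrN; apply: eq_bigr => m /andP[mn jm].
  have := ltn_ord m => m_lt; rewrite (IH (n - m)%N); [|lia..]; rewrite mulrN mulr_sumr; congr (- _).
  rewrite (big_ord_widen_cond n.+1 (fun k => (0 < k)%N && (j.+1 <= k.+1)%N)
    (fun k => c m 0%N * (a k *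
       fps_coef (b ^+ (k.+1 - j.+1)) (n - m - k)))); last lia.
  apply: eq_big => [k|k _]; first by rewrite !ltnS -andbA.
  by rewrite subSS subnAC /=; ring.
congr (- _); rewrite (exchange_big_dep (fun k : 'I_n.+1 => (0 < k)%N && (j <= k)%N)) /=;
  last by move=> m k _ /and3P[-> ->].
rewrite big_mkcond [RHS]big_mkcond; apply: eq_bigr => k _.
have kn := ltn_ord k.
case: ifP => [/andP[k0 jk]|jk]; last first.
  (* Only [k + 1 = j] is left. The power of [b] is then 1, whose coefficient at [n - k > 0]
     vanishes: with all children of the root being leaves, [n] would equal [k]. *)
  case: ifP => // jk'; rewrite (_ : k.+1 - j = 0)%N; last lia.
  by rewrite expr0 /= (_ : n - k == 0 = false)%N ?mulr0//; lia.
rewrite ifT; last lia.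
rewrite subSn// exprS fps_coefM mulr_sumr.
rewrite (big_ord_widen n.+1 (fun i => a k * (fps_coef b i *
  fps_coef (b ^+ (k - j)) (n - k - i)))); last lia.
apply: eq_bigl => m; rewrite k0 jk /=; lia.
Qed.

(** Here [g] is x times [b], so the coefficient of x^(n+1) in the composite is the sum over [k] of
    [a k] times that of x^(n-k) in [b ^+ k.+1]. Its term [k = 0] is the n-th coefficient of [b],
    which the root equation cancels against the rest for [n > 0]. *)
Lemma fps_comp_root (A : comNzRingType) (f g b : fps A) (a : nat -> A) :
  fps_coef f 0 = 0 -> (forall n, fps_coef f n.+1 = a n) ->
  fps_coef g 0 = 0 -> (forall n, fps_coef g n.+1 = fps_coef b n) ->
  a 0%N = 1 -> fps_coef b 0 = 1 ->
  (forall n, (0 < n)%N -> fps_coef b n = - \sum_(k < n.+1 | (0 < k)%N)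
     a k * fps_coef (b ^+ k.+1) (n - k)) ->
  fps_comp f g = fpsX A.
Proof.
move=> f0 fS g0 gS a0 b0 bE; apply/fpsP => -[|n].
  by rewrite /= big_ord_recl big_ord0 f0 mul0r addr0.
rewrite /= big_ord_recl f0 mul0r add0r.
transitivity (\sum_(k < n.+1) a k * fps_coef (b ^+ k.+1) (n - k)).
  apply: eq_bigr => k _; rewrite lift0 fS.
  by rewrite (fps_coef_shiftX g0 gS) ltnS leq_ord subSS.
case: n => [|n].
  by rewrite big_ord_recl big_ord0 addr0 expr1 a0 mul1r b0.
rewrite big_ord_recl expr1 a0 mul1r subn0 bE// [X in - X]big_mkcond.
rewrite [X in - X]big_ord_recl [X in - X]/= add0r; exact: addNr.
Qed.

(** * Signed sums over trees *)

Definition trees n : seq {fset nat * nat} :=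
  [seq T <- fpowerset (box n) | `[< bracketing n T >]].

Lemma trees_uniq n : uniq (trees n).
Proof. by rewrite filter_uniq ?fset_uniq. Qed.

Lemma treesP n T : reflect (bracketing n T) (T \in trees n).
Proof.
rewrite mem_filter; apply: (iffP andP) => [[/asboolP]//|bT].
by split; [exact/asboolP|rewrite fpowersetE bracketing_box].
Qed.

(* The leaves 0, ..., j - 1 are children of the root. *)
Definition free_leaves n j (T : {fset nat * nat}) : bool :=
  `[< forall a b, (a, b) \in T -> (a, b) = (0, n)%N \/ (j <= a)%N >].

(* The child of the root containing leaf j has leaves j, ..., j + m. *)
Definition root_child n j m (T : {fset nat * nat}) : bool :=
  `[< ((0 < m)%N -> (j, j + m)%N \in T) /\
      forall b, (j, b) \in T -> (j, b) <> (0, n)%N -> (b <= j + m)%N >].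

Lemma root_child_uniq n j m m' T : (m < n)%N -> (m' < n)%N ->
  root_child n j m T -> root_child n j m' T -> m = m'.
Proof.
move=> mn mn' /asboolP[Tm maxm] /asboolP[Tm' maxm'].
have le (p q : nat) : (p < n)%N -> ((0 < p)%N -> (j, j + p)%N \in T) ->
    (forall b, (j, b) \in T -> (j, b) <> (0, n)%N -> (b <= j + q)%N) -> (p <= q)%N.
  move=> pn Tp maxq; have [->//|p0] := posnP p.
  by rewrite -(leq_add2l j); apply: maxq; [exact: Tp|move=> []; lia].
by apply/eqP; rewrite eqn_leq; apply/andP; split; apply: le.
Qed.

Lemma root_child_exists n j T : (0 < n)%N -> (j <= n)%N -> bracketing n T ->
  exists m, [/\ (m < n)%N, (j + m <= n)%N & root_child n j m T].
Proof.
move=> n0 jn [Tr _ _].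
pose Q m := [&& (m < n)%N, (j + m <= n)%N & (m == 0%N) || ((j, j + m)%N \in T)].
have Q0 : Q 0%N by rewrite /Q n0 addn0 jn.
have [m /and3P[mn jm Tm] mmax] := ex_maxnP (ex_intro (fun m => is_true (Q m)) 0%N Q0)
  (fun m (Qm : Q m) => ltnW (andP Qm).1).
exists m; split=> //; apply/asboolP; split=> [m0|b jb ne].
  by move: Tm; rewrite eqn0Ngt m0.
have r := Tr _ _ jb; have jbn : (j != 0%N) || (b != n).
  by rewrite -negb_and; apply/negP => /andP[/eqP j0 /eqP bn]; apply: ne; rewrite j0 bn.
suff : (b - j <= m)%N by lia.
apply: mmax; rewrite /Q subnKC ?jb ?orbT ?andbT; lia.
Qed.

(* Pruning a tree at the subtree carried by leaf j, which becomes a leaf. *)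
Lemma prune_bij n j m : (j + m <= n)%N -> (m < n)%N ->
  perm_eq [seq T <- trees n | free_leaves n j T && root_child n j m T]
          [seq graft j m V U | V <- trees m,
             U <- [seq U <- trees (n - m)%N | free_leaves (n - m)%N j.+1 U]].
Proof.
move=> jm mn; have jnm : (j <= n - m)%N by lia.
have nE : (n - m + m = n)%N by lia.
apply: uniq_perm.
- by rewrite filter_uniq ?trees_uniq.
- apply: allpairs_uniq; [exact: trees_uniq|exact/filter_uniq/trees_uniq|].
  move=> [S U] [S' U'] /allpairsPdep[S1 [U1 [/treesP b1]]].
  rewrite mem_filter => /andP[_ /treesP b2] [-> ->].
  move=> /allpairsPdep[S2 [U2 [/treesP b3]]].
  rewrite mem_filter => /andP[_ /treesP b4] [-> ->] /=.
  by move=> /(graft_inj b1 b2 b3 b4)[-> ->].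
move=> T; rewrite mem_filter; apply/idP/allpairsPdep.
  move=> /andP[/andP[/asboolP Tj /asboolP[Tm maxm]] /treesP bT].
  have [||S [U [bS bU TE]]] := @graft_surj j m (n - m) T jnm; rewrite ?nE//.
  exists S, U; split=> //; first exact/treesP.
  rewrite mem_filter; apply/andP; split; last exact/treesP.
  apply/asboolP => c d cd; have [Ur _ _] := bU; have r := Ur _ _ cd.
  have cdT : (graft_left j m c, graft_right j m d) \in T.
    by rewrite TE; apply/graftP; right; exists c, d.
  have [E|ne] := eqVneq (graft_left j m c, graft_right j m d) (0%N, n).
    left; move: E; rewrite /graft_left /graft_right.
    by case=> + +; do 2 case: ifP; move=> *; congr pair; lia.
  right; have [E|] := Tj _ _ cdT; first by rewrite E eqxx in ne.
  have [cj|//] := leqP c j; rewrite /graft_left cj => jc.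
  (* A node of [U] starting at leaf [j] would come from a node of [T], other than the root, that
     starts at [j] and properly contains the pruned child, against the maximality of that child. *)
  have cE : c = j by lia.
  move: cdT ne; rewrite /graft_left cj /graft_right ifF ?cE; last lia.
  by move=> /maxm maxd /eqP /maxd; lia.
move=> [S [U [/treesP bS]]]; rewrite mem_filter => /andP[/asboolP Uj /treesP bU] ->.
have [Sr _ Sm] := bS; have [Ur _ _] := bU.
rewrite -andbA; apply/and3P; split; last by apply/treesP; rewrite -{1}nE; exact: bracketing_graft.
  apply/asboolP => a b /graftP[] [c [d [cd -> ->]]]; first by right; exact: leq_addr.
  have [[-> ->]|jc] := Uj _ _ cd.
    by left; rewrite /graft_left /graft_right leq0n ltnNge jnm nE.
  by right; rewrite /graft_left; case: ifP; lia.
apply/asboolP; split=> [m0|b].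
  by apply/graftP; left; exists 0%N, m; rewrite addn0 Sm.
move=> /graftP[] [c [d [cd jc ->]]]; first by have := Sr _ _ cd; lia.
have [[c0 ->]|jc'] := Uj _ _ cd.
  move: jc; rewrite c0 /graft_left /graft_right leq0n ltnNge jnm nE => -> //.
by move: jc; rewrite /graft_left; case: ifP; lia.
Qed.

Lemma sum_allpairs_mul (A : comNzRingType) (I J K : eqType) (h : I -> J -> K)
    (r : seq I) (s : seq J) (F : K -> A) (G : I -> A) (H : J -> A) :
  (forall i j, i \in r -> j \in s -> F (h i j) = G i * H j) ->
  \sum_(x <- [seq h i j | i <- r, j <- s]) F x =
  (\sum_(i <- r) G i) * \sum_(j <- s) H j.
Proof.
move=> FE; rewrite big_allpairs_dep big_distrlr /= big_seq [RHS]big_seq.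
apply: eq_bigr => i ir; rewrite big_seq [RHS]big_seq.
by apply: eq_bigr => j js; exact: FE.
Qed.

(** * Recursion at the root and the motivic interior as a signed sum *)

Section SignedTreeSums.
Variable R : realType.

Definition tree_class n T : polyring R := poly_class (tree_face R n T).

Lemma tree_class_graft a m k S U : (a <= k)%N -> bracketing m S -> bracketing k U ->
  tree_class (k + m) (graft a m S U) = tree_class m S * tree_class k U.
Proof. by move=> ak bS bU; rewrite poly_classM; apply/poly_classP/tree_face_graft. Qed.

(** The sign counts nodes rather than codimension, which is one less when [n > 0]: node counts are
    additive under [graft], and the extra sign is the minus in front of the interiors in beta. *)
Definition tree_weight n T : polyring R := (-1) ^+ #|` T| * tree_class n T.

Lemma tree_weight_graft a m k S U : (a <= k)%N -> bracketing m S -> bracketing k U ->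
  tree_weight (k + m) (graft a m S U) = tree_weight m S * tree_weight k U.
Proof.
move=> ak bS bU; rewrite /tree_weight (tree_class_graft ak bS bU).
by rewrite (card_graft a bS bU) exprD; ring.
Qed.

Lemma tree_class0 T : tree_class 0 T = 1.
Proof. by rewrite /tree_class (point_uniq (tree_face R 0 T)) poly_class1. Qed.

Lemma associahedronE n : associahedron R n = tree_face R n.+1 (corolla n.+1).
Proof.
apply: polytope_inj; rewrite tree_faceE; last exact: bracketing_corolla.
exact: pset_associahedron.
Qed.

(** This point lies in a space of dimension 1, while the unit is the class of the point of dimension
    0 space; they agree because each has a single face. Hence the powers of [- a_1] in the motivic
    interior are plain signs. *)
Lemma poly_class_associahedron0 : poly_class (associahedron R 0) = 1.
Proof.
rewrite -poly_class1; apply/poly_classP/comb_equivP.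
have only_face F : faces (associahedron R 0) F -> F = associahedron R 0.
  rewrite associahedronE => /(tree_face_tubes (bracketing_corolla 1))[bF _ ->].
  by rewrite (bracketing1 bF).
exists (fun=> Defs.point R), (fun=> associahedron R 0); split.
- by move=> F /only_face ->; split=> //; exact: faces_self.
- by move=> G _; rewrite (point_uniq G); split=> //; exact: faces_self.
by move=> F G /only_face -> /only_face ->; split=> _ x.
Qed.

Definition tree_sum n j : polyring R :=
  \sum_(T <- trees n | free_leaves n j T) tree_weight n T.

Lemma tree_sum0 n : tree_sum n 0 = \sum_(T <- trees n) tree_weight n T.
Proof. by apply: eq_bigl => T; apply/asboolP => a b _; right. Qed.

(** Trees are sorted by the size [m + 1] of the root child containing leaf [j]. Pruning makes that
    child a leaf, so in the remaining tree the first [j + 1] leaves are children of the root. *)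
Lemma tree_sum_rec n j : (0 < n)%N -> (j <= n)%N ->
  tree_sum n j = \sum_(m < n.+1 | (m < n)%N && (j + m <= n)%N)
    tree_sum m 0 * tree_sum (n - m) j.+1.
Proof.
move=> n0 jn; rewrite {1}/tree_sum.
transitivity (\sum_(T <- trees n | free_leaves n j T)
    \sum_(m < n.+1 | [&& (m < n)%N, (j + m <= n)%N & root_child n j m T]) tree_weight n T).
  rewrite big_seq_cond [RHS]big_seq_cond; apply: eq_bigr => T /andP[/treesP bT _].
  have [m [mn jm Tm]] := root_child_exists n0 jn bT.
  have mn' : (m < n.+1)%N by lia.
  rewrite (big_pred1 (Ordinal mn'))// => k; apply/and3P/eqP => [[kn _ Tk]|->//].
  by apply: val_inj; exact: root_child_uniq Tk Tm.
rewrite (exchange_big_dep (fun m : 'I_n.+1 => (m < n)%N && (j + m <= n)%N)) /=; last first.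
  by move=> T m _ /and3P[-> ->].
apply: eq_bigr => m /andP[mn jm].
transitivity (\sum_(T <- [seq T <- trees n | free_leaves n j T && root_child n j m T])
    tree_weight n T).
  by rewrite big_filter; apply: eq_bigl => T; rewrite mn jm.
have -> : tree_sum (n - m) j.+1 =
    \sum_(U <- [seq U <- trees (n - m)%N | free_leaves (n - m)%N j.+1 U])
      tree_weight (n - m) U by rewrite big_filter.
rewrite tree_sum0 -(@sum_allpairs_mul _ _ _ _ (graft j m) _ _ (tree_weight n)).
  by rewrite (perm_big _ (prune_bij jm mn)).
move=> S U /treesP bS; rewrite mem_filter => /andP[_ /treesP bU].
by rewrite -[X in tree_weight X _](subnK (ltnW mn)) tree_weight_graft//; lia.
Qed.

Lemma tree_sum_last n : (0 < n)%N -> tree_sum n n.+1 = - tree_class n (corolla n).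
Proof.
move=> n0; rewrite /tree_sum -big_filter.
rewrite (perm_big [:: corolla n]).
  rewrite big_seq1 /tree_weight.
  have -> : #|` corolla n| = 1%N by case: (n) n0 => // k _; rewrite cardfs1.
  by rewrite expr1 mulN1r.
apply: uniq_perm => //; first by rewrite filter_uniq ?trees_uniq.
move=> T; rewrite mem_filter inE; apply/andP/eqP => [[/asboolP Tn /treesP bT]|->].
  apply/eqP; rewrite eqEfsubset corolla_sub// andbT; apply/fsubsetP => -[a b] ab.
  have [Tr _ _] := bT; have r := Tr _ _ ab; rewrite in_corolla n0 /=; apply/eqP.
  by have [//|] := Tn _ _ ab; lia.
split; last exact/treesP/bracketing_corolla.
by apply/asboolP => a b; rewrite in_corolla => /andP[_ /eqP]; left.
Qed.

Definition tree_series : fps (polyring R) := Fps (fun n => tree_sum n 0).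

Lemma tree_sumE n : (0 < n)%N -> tree_sum n 0 = - \sum_(k < n.+1 | (0 < k)%N)
  tree_class k (corolla k) * fps_coef (tree_series ^+ k.+1) (n - k).
Proof.
move=> n0; rewrite (recurrence_coef tree_sum_last tree_sum_rec)//.
congr (- _); apply: eq_big => [k|k _]; first by rewrite andbT.
by rewrite subn0.
Qed.

Lemma motivic_interiorE n :
  motivic_interior (associahedron R n) = - tree_sum n.+1 0.
Proof.
have bij : set_bij [set` trees n.+1] (faces (associahedron R n)) (tree_face R n.+1).
  have bc := bracketing_corolla n.+1; rewrite associahedronE; split.
  - by move=> T /treesP bT; exact: tree_face_face bc bT (corolla_sub bT).
  - move=> T T' /set_mem /= /treesP bT /set_mem /= /treesP bT' E.
    have := congr1 (fun F : polytope R n.+1 => tubes F) E.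
    by rewrite !tree_faceE// !tubes_bracket_set.
  - move=> F /(tree_face_tubes bc)[bF _ ->]; exists (tubes F) => //.
    exact/treesP.
rewrite /motivic_interior (reindex_fsbig _ _ _ _ bij) poly_class_associahedron0.
rewrite -(fsbig_seq _ _ (trees_uniq _)) tree_sum0 -sumrN big_seq [RHS]big_seq.
apply: eq_bigr => T /treesP bT; rewrite -mulNr /codim associahedronE.
have := affdim_tree_face R (ltn0Sn n) bT.
have := affdim_tree_face R (ltn0Sn n) (bracketing_corolla n.+1).
rewrite /= cardfs1 addn1 => -[->]; set d := affdim _ => dT.
have T0 : (0 < #|` T|)%N.
  by rewrite cardfs_gt0; apply/fset0Pn; exists (0%N, n.+1); have [_ _] := bT; apply.
have -> : #|` T| = (n - d).+1 by move: #|` T| T0 dT => c; lia.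
by rewrite exprS mulN1r opprK.
Qed.

End SignedTreeSums.

Theorem theorem3p4 (R : realType) :
  fps_comp (assoc_alpha R) (assoc_beta R) = fpsX (polyring R) /\
  fps_comp (assoc_beta R) (assoc_alpha R) = fpsX (polyring R).
Proof.
have alpha0 : fps_coef (assoc_alpha R) 0 = 0 by rewrite /= addr0.
have alphaS n : fps_coef (assoc_alpha R) n.+1 = tree_class R n (corolla n).
  case: n => [|n]; first by rewrite /= addr0 tree_class0.
  by rewrite /= add0r associahedronE.
have beta0 : fps_coef (assoc_beta R) 0 = 0 by rewrite /= oppr0 addr0.
have betaS n : fps_coef (assoc_beta R) n.+1 = tree_sum R n 0.
  (* For [n = 0] the only tree is the single leaf, without nodes and of weight 1; it accounts for
     the term x of beta. *)
  case: n => [|n]; last by rewrite /= add0r motivic_interiorE opprK.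
  rewrite /= oppr0 addr0 tree_sum0 (perm_big [:: corolla 0]).
    by rewrite big_seq1 /tree_weight cardfs0 mul1r tree_class0.
  apply: uniq_perm => //; first exact: trees_uniq.
  move=> T; rewrite inE; apply/treesP/eqP => [/bracketing0->//|->].
  exact: (bracketing_corolla 0).
have beta1 : fps_coef (assoc_beta R) 1 = 1.
  by rewrite /= oppr0 addr0.
suff ab : fps_comp (assoc_alpha R) (assoc_beta R) = fpsX (polyring R).
  by split; [exact: ab|exact: (fps_comp_invC alpha0 beta0 beta1 ab)].
apply: (fps_comp_root (b := tree_series R) alpha0 alphaS beta0 betaS _ _ (@tree_sumE R)).
  exact: tree_class0.
exact: etrans (esym (betaS 0%N)) beta1.
Qed.
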